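(* Let $B$ be a closed nondensely defined Hermitian contraction in $\mathfrak H$ with associated $\mathfrak H_0,\mathfrak N,B_0,K_0$, and assume that $\mathfrak D_{K_0^*}=\mathfrak N$. Let $\mathcal H$ be a Hilbert space, let $$X=\begin{bmatrix}X_{11}&X_{12}\\ X_{12}^*&X_{22}\end{bmatrix}$$ be a selfadjoint contraction in $\mathfrak N\oplus\mathcal H$, and let $\widetilde B_X$ be the corresponding selfadjoint contractive extension of $B$ in $\mathfrak H\oplus\mathcal H$, $$\widetilde B_X=\begin{bmatrix}B_0&D_{B_0}K_0^*&0\\ K_0D_{B_0}&-K_0B_0K_0^*+D_{K_0^*}X_{11}D_{K_0^*}&D_{K_0^*}X_{12}\\ 0&X_{12}^*D_{K_0^*}&X_{22}\end{bmatrix}\quad\text{in }\mathfrak H_0\oplus\mathfrak N\oplus\mathcal H .$$ Put $\widehat Z_0=\left((I+X)_{\mathfrak N}-I\right)\upharpoonright\mathfrak N$, $\widehat Z_1=\left(I-(I-X)_{\mathfrak N}\right)\upharpoonright\mathfrak N$, and $$\widehat B_j=\begin{bmatrix}B_0&D_{B_0}K_0^*\\ K_0D_{B_0}&-K_0B_0K_0^*+D_{K_0^*}\widehat Z_jD_{K_0^*}\end{bmatrix}\quad\text{in }\mathfrak H_0\oplus\mathfrak N,\qquad j=0,1.$$ Then $$\widehat B_0=B_\mu+(I+\widetilde B_X)_{\mathfrak N}\upharpoonright\mathfrak H,\qquad \widehat B_1=B_M-(I-\widetilde B_X)_{\mathfrak N}\upharpoonright\mathfrak H .$$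
   Context: All Hilbert spaces are complex and separable. For a contraction $T:H_1\to H_2$, $D_T=(I-T^*T)^{1/2}$ and $\mathfrak D_T$ is the closure of $\operatorname{ran}D_T$. A closed nondensely defined Hermitian contraction $B$ in $\mathfrak H$ is a linear operator defined on a proper closed subspace $\mathfrak H_0=\operatorname{dom}B$ of $\mathfrak H$, with $\|Bf\|\le\|f\|$ and $(Bf,g)=(f,Bg)$ for $f,g\in\mathfrak H_0$. Put $\mathfrak N=\mathfrak H\ominus\mathfrak H_0$, $B_0=P_{\mathfrak H_0}B$ (a selfadjoint contraction in $\mathfrak H_0$), and let $K_0:\mathfrak D_{B_0}\to\mathfrak N$ be the contraction determined by $K_0D_{B_0}f=P_{\mathfrak N}Bf$, $f\in\mathfrak H_0$. Thus $K_0^*:\mathfrak N\to\mathfrak D_{B_0}\subseteq\mathfrak H_0$, and $D_{K_0^*}$ acts in $\mathfrak N$. The selfadjoint contractive extensions of $B$ in $\mathfrak H$ form an operator interval $[B_\mu,B_M]$ whose endpoints are $$B_\mu=\begin{bmatrix}B_0&D_{B_0}K_0^*\\ K_0D_{B_0}&-K_0B_0K_0^*-D_{K_0^*}^2\end{bmatrix},\qquad B_M=\begin{bmatrix}B_0&D_{B_0}K_0^*\\ K_0D_{B_0}&-K_0B_0K_0^*+D_{K_0^*}^2\end{bmatrix}$$ with respect to $\mathfrak H=\mathfrak H_0\oplus\mathfrak N$. For a bounded nonnegative operator $S$ in a Hilbert space $L$ and a closed subspace $K\subseteq L$, the shorted operator is $S_K=\max\{Z\in\mathbf L(L):0\le Z\le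 S,\ \operatorname{ran}Z\subseteq K\}$; equivalently $(S_Kf,f)=\inf_{\varphi\in L\ominus K}(S(f+\varphi),f+\varphi)$, $f\in L$. Direct summands are identified with the corresponding subspaces of the orthogonal sum. *)

(* Defs.v *)
From HB Require Import structures.
From mathcomp Require Import all_boot all_order all_algebra.
From mathcomp Require Import all_classical all_reals topology normedtype.
From mathcomp Require Import complex.

Set Implicit Arguments.
Unset Strict Implicit.
Unset Printing Implicit Defensive.

Import Order.TTheory GRing.Theory Num.Theory Num.Def.
Import numFieldNormedType.Exports.

Local Open Scope classical_set_scope.
Local Open Scope ring_scope.

(* The inner product is linear in its first argument. *)
HB.mixin Record isHilbert (R : realType) V & CompleteNormedModule R[i] V := {
  inner : {dot V for (@conjC R[i])};
  inner_norm : forall x : V, inner x x = `|x| ^+ 2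
}.
#[short(type="hilbertType")]
HB.structure Definition Hilbert (R : realType) :=
  {V of CompleteNormedModule R[i] V & isHilbert R V}.

Definition separable_space (T : topologicalType) :=
  exists2 A : set T, countable A & dense A.

Section DotTheory.
Variables (C : numClosedFieldType) (V : lmodType C) (f : {dot V for (@conjC C)}).

Lemma dot_CauchySchwarz u v : `|f u v| ^+ 2 <= f u u * f v v.
Proof.
have [-> | nz_v] := eqVneq v 0.
  by rewrite !linear0r normr0 expr0n/= mulr0.
pose a := f u v / f v v; pose w := u - a *: v.
have ow : f w v = 0.
  by rewrite linearBl linearZl_LR/= divfK ?dnorm_eq0 ?subrr.
have -> : u = w + a *: v by rewrite subrK.
have -> : f (w + a *: v) v = a * f v v.
  by rewrite linearDl /= ow add0r linearZl_LR.
rewrite hnormDd/=; last by rewrite linearZr_LR/= ow mulr0.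
rewrite normrM (ger0_norm (dnorm_ge0 f v)) exprMn dnormZ mulrDl.
by rewrite -[X in _ <= _ + X]mulrA -expr2 lerDr mulr_ge0// dnorm_ge0.
Qed.

Lemma dot_triangle u v :
  sqrtC (f (u + v) (u + v)) <= sqrtC (f u u) + sqrtC (f v v).
Proof.
have s0 w : 0 <= sqrtC (f w w) by rewrite sqrtC_ge0 dnorm_ge0.
rewrite -ler_sqr ?nnegrE ?addr_ge0//.
rewrite sqrrD !sqrtCK addrAC dnormD lerD2l.
have h : `|f u v| <= sqrtC (f u u) * sqrtC (f v v).
  rewrite -ler_sqr ?nnegrE ?mulr_ge0//.
  by rewrite exprMn !sqrtCK dot_CauchySchwarz.
have -> : f u v + conjC (f u v) = 'Re (f u v) *+ 2.
  by rewrite -mulr_natr ReE divfK// pnatr_eq0.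
rewrite lerMn2r/=; apply: le_trans h.
exact: (leif_Re_Creal (f u v)).1.
Qed.
End DotTheory.

Lemma innerC (R : realType) (H : hilbertType R) (x y : H) :
  inner x y = conjC (inner y x).
Proof. by rewrite (hermC inner) expr0 mul1r. Qed.

Lemma contraction_cauchy (K0 : numFieldType) (V W : normedModType K0) (g : {linear V -> W})
  (F : set_system V) : ProperFilter F -> (forall x, `|g x| <= `|x|) ->
  cauchy F -> cauchy (g @ F).
Proof.
move=> FF gle /cauchy_ballP Fc; apply/cauchy_ballP => e e0.
have [[A B] /= [FA FB] AB] := Fc e e0.
exists (g @` A, g @` B).
  by split=> /=; [apply: filterS FA|apply: filterS FB] => x Ax; exists x.
move=> [_ _] [/= [x Ax <-] [y By <-]].
have := AB (x, y) (conj Ax By).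
rewrite -!ball_normE /= -linearB; exact: le_lt_trans.
Qed.

(* The orthogonal sum H (+) K, with norm sqrt(|x|^2 + |y|^2). The product type
   H * K itself carries the sup norm in the library, hence the alias. *)
Definition hsum (R : realType) (H K : hilbertType R) : Type := (H * K)%type.

Section HilbertSum.
Context {R : realType} {H K : hilbertType R}.
Local Notation L := (hsum H K).

HB.instance Definition _ := GRing.Lmodule.copy L (H * K)%type.

Definition hsum_inner (x y : L) : R[i] := inner x.1 y.1 + inner x.2 y.2.

Let hsum_inner_bilinear : bilinear_for
  (GRing.Scale.Law.clone _ _ *%R _) (GRing.Scale.Law.clone _ _ (conjC \; *%R) _)
  hsum_inner.
Proof.
split=> [u' a x y|u a x y] /=; rewrite /hsum_inner /=.
  by rewrite !linearPl/= mulrDr addrACA.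
by rewrite !linearPr/= mulrDr addrACA.
Qed.
HB.instance Definition _ := bilinear_isBilinear.Build R[i] L L R[i]
  (GRing.Scale.Law.clone _ _ *%R _) (GRing.Scale.Law.clone _ _ (conjC \; *%R) _)
  hsum_inner hsum_inner_bilinear.
Let hsum_inner_herm (x y : L) :
  hsum_inner x y = (-1) ^+ false * conjC (hsum_inner y x).
Proof.
by rewrite expr0 mul1r /hsum_inner (innerC x.1) (innerC x.2) rmorphD.
Qed.
HB.instance Definition _ := isHermitianSesquilinear.Build R[i] L false conjC
  hsum_inner hsum_inner_herm.
Let hsum_inner_gt0 (x : L) : x != 0 -> 0 < hsum_inner x x.
Proof.
move=> x0; rewrite lt_neqAle eq_sym /hsum_inner addr_ge0 ?dnorm_ge0// andbT.
rewrite paddr_eq0 ?dnorm_ge0// !dnorm_eq0.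
by case: x x0 => a b /=; rewrite -pair_eqE.
Qed.
HB.instance Definition _ := isDotProduct.Build R[i] L hsum_inner hsum_inner_gt0.

Definition hsum_norm (x : L) : R[i] := sqrtC (hsum_inner x x).
Let hsum_normD (x y : L) : hsum_norm (x + y) <= hsum_norm x + hsum_norm y.
Proof. exact: (dot_triangle hsum_inner). Qed.
Let hsum_normZ a (x : L) : hsum_norm (a *: x) = `|a| * hsum_norm x.
Proof.
rewrite /hsum_norm (dnormZ hsum_inner).
rewrite sqrtCM ?nnegrE ?exprn_ge0 ?(dnorm_ge0 hsum_inner)//.
by rewrite sqrCK.
Qed.
Let hsum_norm_eq0 (x : L) : hsum_norm x = 0 -> x = 0.
Proof.
by move/eqP; rewrite sqrtC_eq0 (dnorm_eq0 hsum_inner) => /eqP.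
Qed.
HB.instance Definition _ := Lmodule_isNormed.Build R[i] L
  hsum_normD hsum_normZ hsum_norm_eq0.

Lemma hsum_norm2 (x : L) : `|x| ^+ 2 = `|x.1| ^+ 2 + `|x.2| ^+ 2.
Proof. by rewrite -[`|x|]/(hsum_norm x) sqrtCK /hsum_inner !inner_norm. Qed.

Lemma hsum_norm_fst (x : L) : `|x.1| <= `|x|.
Proof. by rewrite -ler_sqr ?nnegrE// hsum_norm2 lerDl exprn_ge0. Qed.

Lemma hsum_norm_snd (x : L) : `|x.2| <= `|x|.
Proof. by rewrite -ler_sqr ?nnegrE// hsum_norm2 lerDr exprn_ge0. Qed.

Lemma hsum_norm_le (x : L) : `|x| <= `|x.1| + `|x.2|.
Proof.
rewrite -ler_sqr ?nnegrE ?addr_ge0// hsum_norm2 sqrrD -addrA lerD2l.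
by rewrite lerDr mulrn_wge0// mulr_ge0.
Qed.

Definition hfst (x : L) : H := x.1.
Definition hsnd (x : L) : K := x.2.
Definition hinl (x : H) : L := (x, 0).
Definition hinr (y : K) : L := (0, y).

Let hfst_lin : linear hfst. Proof. by []. Qed.
Let hsnd_lin : linear hsnd. Proof. by []. Qed.
Let hinl_lin : linear hinl.
Proof.
by move=> a x y; apply/eqP; rewrite -pair_eqE /pair_eq /= scaler0 addr0 !eqxx.
Qed.
Let hinr_lin : linear hinr.
Proof.
by move=> a x y; apply/eqP; rewrite -pair_eqE /pair_eq /= scaler0 addr0 !eqxx.
Qed.
HB.instance Definition _ := GRing.isLinear.Build R[i] L H _ hfst hfst_lin.
HB.instance Definition _ := GRing.isLinear.Build R[i] L K _ hsnd hsnd_lin.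
HB.instance Definition _ := GRing.isLinear.Build R[i] H L _ hinl hinl_lin.
HB.instance Definition _ := GRing.isLinear.Build R[i] K L _ hinr hinr_lin.

Let hsum_complete (F : set_system L) : ProperFilter F -> cauchy F -> cvg F.
Proof.
move=> FF Fc.
have /cauchy_cvgP c1 := @contraction_cauchy _ _ _ hfst F FF hsum_norm_fst Fc.
have /cauchy_cvgP c2 := @contraction_cauchy _ _ _ hsnd F FF hsum_norm_snd Fc.
apply/cvg_ex; exists ((lim (hfst @ F), lim (hsnd @ F)) : L).
apply/cvgrPdist_lt => e e0; near=> x.
apply: le_lt_trans (hsum_norm_le _) _ => /=; rewrite (splitr e) ltrD//=.
  near: x; move/cvgrPdist_lt : c1; apply; rewrite divr_gt0//.
near: x; move/cvgrPdist_lt : c2; apply; rewrite divr_gt0//.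
Unshelve. all: by end_near. Qed.
HB.instance Definition _ := Uniform_isComplete.Build L hsum_complete.
Let hsum_inner_norm (x : L) : hsum_inner x x = `|x| ^+ 2.
Proof. by rewrite -[`|x|]/(hsum_norm x) sqrtCK. Qed.
HB.instance Definition _ := isHilbert.Build R L hsum_inner_norm.
End HilbertSum.

(* Closed linear subspaces; a closed subspace K coerces to the Hilbert space of
   its elements. *)
Record csubspace (R : realType) (H : hilbertType R) := CSubspace {
  cs_set : set H;
  cs_set0 : cs_set 0;
  cs_setP : forall (a : R[i]) x y, cs_set x -> cs_set y -> cs_set (a *: x + y);
  cs_setC : closed cs_set
}.

Arguments cs_setC {R H} c.
Arguments cs_set0 {R H} c.

Definition cs_pred (R : realType) (H : hilbertType R) (K : csubspace H) :
  {pred H} := fun x => x \in cs_set K.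

Record cs_sort (R : realType) (H : hilbertType R) (K : csubspace H) := CsElt {
  cs_val : H;
  cs_valP : cs_val \in cs_pred K
}.
Coercion cs_sort : csubspace >-> Sortclass.

Section Subspace.
Context {R : realType} {H : hilbertType R} (K : csubspace H).

Let cs_submod_closed : subsemimod_closed (cs_pred K).
Proof.
split; [split|].
- by rewrite inE; exact: cs_set0.
- move=> x y; rewrite !inE => Kx Ky.
  by rewrite -[x]scale1r; exact: cs_setP.
- move=> a x; rewrite !inE => Kx.
  by rewrite -[_ *: _]addr0; apply: cs_setP => //; exact: cs_set0.
Qed.
HB.instance Definition _ :=
  GRing.isSubmodClosed.Build R[i] H (cs_pred K) cs_submod_closed.
HB.instance Definition _ := [isSub of cs_sort K for @cs_val R H K].
HB.instance Definition _ := [Choice of cs_sort K by <:].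
HB.instance Definition _ := [SubChoice_isSubLmodule of cs_sort K by <:].

Let cs_normD (x y : K) : `|val (x + y)| <= `|val x| + `|val y|.
Proof. exact: ler_normD. Qed.
Let cs_normZ a (x : K) : `|val (a *: x)| = `|a| * `|val x|.
Proof. exact: normrZ. Qed.
Let cs_norm_eq0 (x : K) : `|val x| = 0 -> x = 0.
Proof. by move/eqP; rewrite normr_eq0 => /eqP x0; apply/val_inj. Qed.
HB.instance Definition _ := Lmodule_isNormed.Build R[i] (cs_sort K)
  cs_normD cs_normZ cs_norm_eq0.

Definition cs_incl (x : K) : H := val x.
Let cs_incl_lin : linear cs_incl. Proof. by []. Qed.
HB.instance Definition _ := GRing.isLinear.Build R[i] (cs_sort K) H _ cs_incl cs_incl_lin.

Let cs_complete (F : set_system K) : ProperFilter F -> cauchy F -> cvg F.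
Proof.
move=> FF Fc.
have /cauchy_cvgP c := @contraction_cauchy _ _ _ cs_incl F FF (fun=> lexx _) Fc.
have Kl : cs_set K (lim (cs_incl @ F)).
  apply: (@closed_cvg _ _ F _ cs_incl (cs_set K) (cs_setC K) _ _ c).
  by apply: nearW => x; exact: (set_mem (cs_valP x)).
apply/cvg_ex; exists (CsElt (mem_set Kl)).
by apply/cvgrPdist_lt => e e0; move/cvgrPdist_lt : c; apply.
Qed.
HB.instance Definition _ := Uniform_isComplete.Build (cs_sort K) cs_complete.

Definition cs_inner (x y : K) : R[i] := inner (val x) (val y).
Let cs_inner_bilinear : bilinear_for
  (GRing.Scale.Law.clone _ _ *%R _) (GRing.Scale.Law.clone _ _ (conjC \; *%R) _)
  cs_inner.
Proof. by split=> [u' a x y|u a x y]; rewrite /cs_inner ?linearPl ?linearPr. Qed.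
HB.instance Definition _ := bilinear_isBilinear.Build R[i] (cs_sort K) (cs_sort K) R[i]
  (GRing.Scale.Law.clone _ _ *%R _) (GRing.Scale.Law.clone _ _ (conjC \; *%R) _)
  cs_inner cs_inner_bilinear.
Let cs_inner_herm (x y : K) :
  cs_inner x y = (-1) ^+ false * conjC (cs_inner y x).
Proof. by rewrite expr0 mul1r /cs_inner innerC. Qed.
HB.instance Definition _ := isHermitianSesquilinear.Build R[i] (cs_sort K) false conjC
  cs_inner cs_inner_herm.
Let cs_inner_gt0 (x : K) : x != 0 -> 0 < cs_inner x x.
Proof. by move=> x0; rewrite dnorm_gt0. Qed.
HB.instance Definition _ := isDotProduct.Build R[i] (cs_sort K) cs_inner cs_inner_gt0.
Let cs_inner_norm (x : K) : cs_inner x x = `|x| ^+ 2.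
Proof. exact: inner_norm. Qed.
HB.instance Definition _ := isHilbert.Build R (cs_sort K) cs_inner_norm.
End Subspace.

(* Bounded (i.e. continuous) linear operators H -> K, as an R[i]-module. *)
Section BoundedOperators.
Context {R : realType} (H K : hilbertType R).

Definition bop_pred : {pred (H -> K)} := fun f => `[< linear f /\ continuous f >].

Record bop := Bop { bop_fun :> H -> K; bop_funP : bop_fun \in bop_pred }.

Let bop_submod_closed : subsemimod_closed bop_pred.
Proof.
split; [split|].
- apply/asboolP; split=> [a x y|x]; first by rewrite /= scaler0 addr0.
  exact: cvg_cst.
- move=> f g /asboolP[lf cf] /asboolP[lg cg]; apply/asboolP; split=> [a x y|x].
    by rewrite !fctE lf lg scalerDr addrACA.
  by apply: cvgD; [exact: cf|exact: cg].
- move=> b f /asboolP[lf cf]; apply/asboolP; split=> [a x y|x].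
    by rewrite !scalrfctE lf scalerDr !scalerA mulrC.
  by apply: cvgZl_tmp; exact: cf.
Qed.
HB.instance Definition _ :=
  GRing.isSubmodClosed.Build R[i] (H -> K) bop_pred bop_submod_closed.
HB.instance Definition _ := [isSub for bop_fun].
HB.instance Definition _ := [Choice of bop by <:].
HB.instance Definition _ := [SubChoice_isSubLmodule of bop by <:].

Lemma bop_linear (T : bop) : linear T.
Proof. by have /asboolP[] := bop_funP T. Qed.
Lemma bop_continuous (T : bop) : continuous T.
Proof. by have /asboolP[] := bop_funP T. Qed.
HB.instance Definition _ (T : bop) :=
  GRing.isLinear.Build R[i] H K _ (bop_fun T) (bop_linear T).

Lemma bopP (T T' : bop) : (forall x, T x = T' x) -> T = T'.
Proof. by move=> TT'; apply/val_inj/funext. Qed.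

Definition mkbop (f : {linear H -> K}) (cf : continuous f) : bop :=
  @Bop f (asboolT (conj (@linearP _ _ _ _ f) cf)).

End BoundedOperators.

Section Operators.
Context {R : realType}.
Implicit Types H K L : hilbertType R.

Lemma contraction_continuous (V W : normedModType R[i]) (f : {linear V -> W}) :
  (forall x, `|f x| <= `|x|) -> continuous f.
Proof.
move=> fle x; apply/(@cvgrPdist_lt _ _ _ (nbhs x)) => e e0; near=> y.
rewrite -linearB; apply: le_lt_trans (fle _) _.
by near: y; apply: cvgr_dist_lt.
Unshelve. all: by end_near. Qed.

Lemma comp_bop_continuous H K L (S : bop K L) (T : bop H K) : continuous (S \o T).
Proof. by move=> x; apply: continuous_comp; apply: bop_continuous. Qed.
Definition bop_comp H K L (S : bop K L) (T : bop H K) : bop H L :=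
  @mkbop R H L (S \o T) (@comp_bop_continuous H K L S T).

Lemma id_bop_continuous H : continuous (idfun : H -> H).
Proof. by move=> x; exact: cvg_id. Qed.
Definition bop_id H : bop H H := @mkbop R H H idfun (@id_bop_continuous H).

Lemma hsum_norm_inl H K (x : H) : `|hinl x : hsum H K| <= `|x|.
Proof. by apply: le_trans (hsum_norm_le _) _; rewrite /= normr0 addr0. Qed.
Lemma hsum_norm_inr H K (x : K) : `|hinr x : hsum H K| <= `|x|.
Proof. by apply: le_trans (hsum_norm_le _) _; rewrite /= normr0 add0r. Qed.

Definition inl_op H K : bop H (hsum H K) :=
  mkbop (contraction_continuous (@hsum_norm_inl H K)).
Definition inr_op H K : bop K (hsum H K) :=
  mkbop (contraction_continuous (@hsum_norm_inr H K)).
Definition fst_op H K : bop (hsum H K) H :=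
  mkbop (contraction_continuous (@hsum_norm_fst R H K)).
Definition snd_op H K : bop (hsum H K) K :=
  mkbop (contraction_continuous (@hsum_norm_snd R H K)).
Lemma cs_incl_norm H (K : csubspace H) (x : K) : `|cs_incl x| <= `|x|.
Proof. by []. Qed.
Definition incl_op H (K : csubspace H) : bop K H :=
  mkbop (contraction_continuous (@cs_incl_norm H K)).

(* The operators below are selected by choice among those satisfying their
   defining property, with default value 0 if there is none. *)
Definition adj H K (T : bop H K) : bop K H :=
  xget 0 [set A : bop K H | forall x y, inner (T x) y = inner x (A y)].

Definition oproj H (K : csubspace H) : bop H K :=
  xget 0 [set P : bop H K |
    forall x (y : K), inner (x - incl_op K (P x)) (incl_op K y) = 0].

Definition nonneg H (S : bop H H) := forall x, 0 <= inner (S x) x.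

Definition op_sqrt H (S : bop H H) : bop H H :=
  xget 0 [set Q : bop H H | nonneg Q /\ bop_comp Q Q = S].

Lemma inner_le H (x y : H) : `|inner x y| <= `|x| * `|y|.
Proof.
rewrite -ler_sqr ?nnegrE ?mulr_ge0// exprMn -!inner_norm.
exact: dot_CauchySchwarz.
Qed.

Lemma closure_csubspace H (A : set H) (x y : H) (a : R[i]) :
  (forall (a : R[i]) x y, A x -> A y -> A (a *: x + y)) ->
  closure A x -> closure A y -> closure A (a *: x + y).
Proof.
move=> AP Ax Ay B nB.
have cf : (fun p : H * H => a *: p.1 + p.2) @ (x, y) --> a *: x + y.
  apply: cvgD; last exact: cvg_snd.
  by apply: cvgZl_tmp; exact: cvg_fst.
have [[U V] /= [nU nV] UV] := cf B nB.
have [u [Au Uu]] := Ax U nU; have [v [Av Vv]] := Ay V nV.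
by exists (a *: u + v); split; [exact: AP|exact: (UV (u, v))].
Qed.

Lemma range_csubspace H K (T : bop H K) (a : R[i]) x y :
  range T x -> range T y -> range T (a *: x + y).
Proof. by move=> [u _ <-] [v _ <-]; exists (a *: u + v) => //; rewrite linearP. Qed.

Definition closed_range H K (T : bop H K) : csubspace K :=
  @CSubspace R K (closure (range T))
    (subset_closure (ex_intro2 _ _ 0 I (linear0 T)))
    (fun a x y => @closure_csubspace K (range T) x y a (@range_csubspace H K T))
    (@closed_closure _ _).

Definition orthc_set H (A : set H) : set H :=
  [set x | forall y, A y -> inner x y = 0].
Lemma orthc_set0 H (A : set H) : orthc_set A 0.
Proof. by move=> y _; rewrite linear0l. Qed.
Lemma orthc_setP H (A : set H) (a : R[i]) (x y : H) :
  orthc_set A x -> orthc_set A y -> orthc_set A (a *: x + y).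
Proof. by move=> xA yA z Az; rewrite linearPl/= xA// yA// mulr0 addr0. Qed.
Lemma closed_orthc H (A : set H) : closed (orthc_set A).
Proof.
move=> x xA y Ay /=; apply/eqP; apply: contraT => xy0.
pose e := `|inner x y| / (`|y| + 1).
have y0 : 0 < `|y| + 1 by rewrite ltr_wpDl.
have e0 : 0 < e by rewrite divr_gt0 ?normr_gt0.
have [a [/= aA]] := xA _ (nbhsx_ballx x e e0).
rewrite -ball_normE /= => xa.
have xya : inner x y = inner (x - a) y by rewrite linearBl/= (aA y Ay) subr0.
have : `|inner x y| <= e * `|y|.
  by rewrite xya; apply: le_trans (inner_le _ _) _; rewrite ler_wpM2r// ltW.
have -> : `|inner x y| = e * (`|y| + 1) by rewrite /e divfK// lt0r_neq0.
by rewrite ler_pM2l// gerDl => /(lt_le_trans ltr01); rewrite ltxx.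
Qed.
Definition orthc H (K : csubspace H) : csubspace H :=
  CSubspace (@orthc_set0 H (cs_set K)) (@orthc_setP H (cs_set K))
    (@closed_orthc H (cs_set K)).

Definition full_csubspace H : csubspace H :=
  @CSubspace R H setT I (fun _ _ _ _ _ => I) closedT.

Definition suml_set H K (N : csubspace H) : set (hsum H K) :=
  [set p | cs_set N p.1 /\ p.2 = 0].
Lemma suml_set0 H K (N : csubspace H) : suml_set N (0 : hsum H K).
Proof. by split=> //; exact: cs_set0. Qed.
Lemma suml_setP H K (N : csubspace H) (a : R[i]) (p q : hsum H K) :
  suml_set N p -> suml_set N q -> suml_set N (a *: p + q).
Proof.
move=> [p1 p2] [q1 q2]; split=> /=; first exact: cs_setP.
by rewrite p2 q2 scaler0 addr0.
Qed.
Lemma closed_suml H K (N : csubspace H) : closed (@suml_set H K N).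
Proof.
apply: closedI.
  apply: (@preimage_closed _ _ (fst_op H K)); last exact: cs_setC.
  by move=> x _; exact: bop_continuous.
apply: (@preimage_closed _ _ (snd_op H K) [set 0]).
  by move=> x _; exact: bop_continuous.
exact: accessible_closed_set1 (hausdorff_accessible (@norm_hausdorff _ K)) _.
Qed.
Definition suml_csubspace H K (N : csubspace H) : csubspace (hsum H K) :=
  CSubspace (@suml_set0 H K N) (@suml_setP H K N) (@closed_suml H K N).

End Operators.

Notation "S *o T" := (bop_comp S T) (at level 40, left associativity).

Section Shorted.
Context {R : realType} {L : hilbertType R}.

Definition op_le (S T : bop L L) := nonneg (T - S).

Definition short_class (S : bop L L) (K : csubspace L) : set (bop L L) :=
  [set Z | [/\ op_le 0 Z, op_le Z S & forall f, cs_set K (Z f)]].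

Definition shorted (S : bop L L) (K : csubspace L) : bop L L :=
  xget 0 [set Z | short_class S K Z /\
                  forall Z', short_class S K Z' -> op_le Z' Z].
End Shorted.

Section Defect.
Context {R : realType} {H K : hilbertType R} (T : bop H K).

Definition contractive := forall f, `|T f| <= `|f|.

Definition defect : bop H H := op_sqrt (bop_id H - adj T *o T).

Definition defect_space : csubspace H := closed_range defect.

Lemma defect_spaceP f : defect f \in cs_pred defect_space.
Proof. by apply: mem_set; apply: subset_closure; exists f. Qed.

(* D_T seen as an operator into the closure of its range. *)
Definition defect_cor_fun (f : H) : defect_space := CsElt (defect_spaceP f).
Lemma defect_cor_linear : linear defect_cor_fun.
Proof. by move=> a f g; apply: val_inj; rewrite /= linearP. Qed.
HB.instance Definition _ := GRing.isLinear.Build R[i] H defect_space _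
  defect_cor_fun defect_cor_linear.
Lemma defect_cor_continuous : continuous defect_cor_fun.
Proof.
move=> f; apply/(@cvgrPdist_lt _ _ _ (nbhs f)) => e e0.
have /cvgrPdist_lt := @bop_continuous _ _ _ defect f; exact.
Qed.
Definition defect_cor : bop H defect_space := mkbop defect_cor_continuous.
End Defect.

Section Blocks.
Context {R : realType} {H L : hilbertType R}.

(* Block operators in H (+) L. *)
Definition block_sum
    (A11 : bop H H) (A12 : bop L H)
    (A21 : bop H L) (A22 : bop L L) : bop (hsum H L) (hsum H L) :=
  inl_op H L *o A11 *o fst_op H L + inl_op H L *o A12 *o snd_op H L +
  inr_op H L *o A21 *o fst_op H L + inr_op H L *o A22 *o snd_op H L.

Variable (H0 : csubspace H).
Let N := orthc H0.

(* Block operators in H, with respect to H = H0 (+) N. *)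
Definition block_sub
    (A11 : bop H0 H0) (A12 : bop N H0)
    (A21 : bop H0 N)  (A22 : bop N N) : bop H H :=
  incl_op H0 *o A11 *o oproj H0 + incl_op H0 *o A12 *o oproj N +
  incl_op N *o A21 *o oproj H0 + incl_op N *o A22 *o oproj N.

(* Block operators in H (+) L, with respect to H0 (+) N (+) L. *)
Definition block3
    (A11 : bop H0 H0) (A12 : bop N H0) (A13 : bop L H0)
    (A21 : bop H0 N)  (A22 : bop N N)  (A23 : bop L N)
    (A31 : bop H0 L)  (A32 : bop N L)  (A33 : bop L L) :
    bop (hsum H L) (hsum H L) :=
  let j1 : bop H0 (hsum H L) := inl_op H L *o incl_op H0 in
  let j2 : bop N (hsum H L) := inl_op H L *o incl_op N in
  let j3 : bop L (hsum H L) := inr_op H L in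
  let p1 : bop (hsum H L) H0 := oproj H0 *o fst_op H L in
  let p2 : bop (hsum H L) N := oproj N *o fst_op H L in
  let p3 : bop (hsum H L) L := snd_op H L in
  (j1 *o A11 *o p1 + j1 *o A12 *o p2 + j1 *o A13 *o p3) +
  (j2 *o A21 *o p1 + j2 *o A22 *o p2 + j2 *o A23 *o p3) +
  (j3 *o A31 *o p1 + j3 *o A32 *o p2 + j3 *o A33 *o p3).

(* If T maps the summand H of H (+) L into itself, this is T restricted to H. *)
Definition restr (T : bop (hsum H L) (hsum H L)) : bop H H :=
  fst_op H L *o T *o inl_op H L.
End Blocks.

Section HermitianContraction.
Context {R : realType} {H : hilbertType R} {H0 : csubspace H}.
Variable B : bop H0 H.
Let N := orthc H0.

Definition B_0 : bop H0 H0 := oproj H0 *o B.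

Definition hermitian_op :=
  forall f g : H0, inner (B f) (incl_op H0 g) = inner (incl_op H0 f) (B g).

Variable K0 : bop (defect_space B_0) N.

Definition D_K0s : bop N N := defect (adj K0).

Definition DK : bop N H0 := defect B_0 *o incl_op (defect_space B_0) *o adj K0.
Definition KD : bop H0 N := K0 *o defect_cor B_0.
(* defect_space B_0 is invariant under B_0, so the projection only corestricts
   B_0 to defect_space B_0. *)
Definition KBK : bop N N :=
  K0 *o (oproj (defect_space B_0) *o B_0 *o incl_op (defect_space B_0)) *o adj K0.

Definition B_mu : bop H H := block_sub B_0 DK KD (- KBK - D_K0s *o D_K0s).
Definition B_M : bop H H := block_sub B_0 DK KD (- KBK + D_K0s *o D_K0s).

Definition B_hat (Z : bop N N) : bop H H :=
  block_sub B_0 DK KD (- KBK + D_K0s *o Z *o D_K0s).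

Variable L : hilbertType R.

Definition B_tilde (X11 : bop N N) (X12 : bop L N) (X22 : bop L L) :
    bop (hsum H L) (hsum H L) :=
  block3
    B_0 DK                            0
    KD  (- KBK + D_K0s *o X11 *o D_K0s) (D_K0s *o X12)
    0   (adj X12 *o D_K0s)            X22.

End HermitianContraction.

Section ContractionX.
Context {R : realType} {N L : hilbertType R}.
Variable X : bop (hsum N L) (hsum N L).

Let I := bop_id (hsum N L).
Let summandN : csubspace (hsum N L) := suml_csubspace L (full_csubspace N).

Definition Z_hat0 : bop N N := restr (shorted (I + X) summandN - I).
Definition Z_hat1 : bop N N := restr (I - shorted (I - X) summandN).
End ContractionX.

(* Main.v *)
(** Write [D = D_{K0^*}]. With [n = P_N u], [h = P_{H0} u] and [k = K0^* n], the
    identity [I = K0 K0^* + D^2] on [N] splits the form of [I + B_X] at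
    [u (+) l] as
      [q(h, k) + ((I + X)(D n (+) l), D n (+) l)],
    where [q] only involves [B0] and [D_{B0}].  For [k = D_{B0} g] one has
    [q(h, k) = ((I + B0) w, w)] with [w = h + (I - B0) g]; hence [q >= 0] for [k]
    in the closure of [ran D_{B0}], and [q(., k)] has infimum [0].  Taking the
    infimum over [h] and [l] gives [(I + B_X)_N = D (I + X)_N D], and the first
    equality follows.  The second one is the same argument with [-B0],
    [-D_{B0}], [-X] in place of [B0], [D_{B0}], [X].

    Shorted operators are built as [S_K = Q P Q], with [Q] the nonnegative square
    root of [S] and [P] the projection onto the orthogonal complement of
    [Q (K^perp)].  The square root of [S <= M] is [sqrt M (I - Y)], where [Y] is
    the strong limit of the iteration [Y' = (A + Y^2) / 2], [A = I - S / M]. *)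

Require Import Defs.
From HB Require Import structures.
From mathcomp Require Import all_boot all_order all_algebra.
From mathcomp Require Import all_classical all_reals topology normedtype.
From mathcomp Require Import complex ring lra.
Import Order.TTheory GRing.Theory Num.Theory.
Import numFieldNormedType.Exports.
Local Open Scope classical_set_scope.
Local Open Scope ring_scope.

Set Implicit Arguments.
Unset Strict Implicit.

(** * Inner products and orthogonal projections *)

Section Inner.
Context {R : realType} {H : hilbertType R}.
Implicit Types (x y z : H) (a : R[i]).

Lemma innerDl x y z : inner (x + y) z = inner x z + inner y z.
Proof. exact: linearDl. Qed.
Lemma innerDr x y z : inner z (x + y) = inner z x + inner z y.
Proof. exact: linearDr. Qed.
Lemma innerBl x y z : inner (x - y) z = inner x z - inner y z.
Proof. exact: linearBl. Qed.
Lemma innerBr x y z : inner z (x - y) = inner z x - inner z y.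
Proof. exact: linearBr. Qed.
Lemma innerNl x z : inner (- x) z = - inner x z.
Proof. exact: linearNl. Qed.
Lemma innerNr x z : inner z (- x) = - inner z x.
Proof. exact: linearNr. Qed.
Lemma innerZl a x z : inner (a *: x) z = a * inner x z.
Proof. exact: linearZl_LR. Qed.
Lemma innerZr a x z : inner z (a *: x) = a^* * inner z x.
Proof. exact: linearZr_LR. Qed.
Lemma inner0l z : inner 0 z = 0. Proof. exact: linear0l. Qed.
Lemma inner0r z : inner z 0 = 0. Proof. exact: linear0r. Qed.

Lemma inner_ge0 x : 0 <= inner x x. Proof. exact: dnorm_ge0. Qed.

Lemma inner_eq0 x : inner x x = 0 -> x = 0.
Proof. by move/eqP; rewrite dnorm_eq0 => /eqP. Qed.

Lemma eq_inner x y : (forall z, inner x z = inner y z) -> x = y.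
Proof.
move=> xy; apply/eqP; rewrite -subr_eq0; apply/eqP/inner_eq0.
by rewrite innerBl xy subrr.
Qed.

Lemma inner_sym0 x y : inner x y = 0 -> inner y x = 0.
Proof. by move=> xy; rewrite innerC xy rmorph0. Qed.

Lemma inner_cvgl {F : set_system H} {FF : Filter F} z x :
  F --> x -> (fun y => inner y z) @ F --> inner x z.
Proof.
move=> Fx; apply/cvgrPdist_lt => e e0.
(* Adding 1 keeps the divisor positive when [z] is zero. *)
have z0 : 0 < `|z| + 1 by rewrite ltr_wpDl.
have ez : 0 < e / (`|z| + 1) by rewrite divr_gt0.
near=> y; rewrite -innerBl; apply: le_lt_trans (inner_le _ _) _.
have xy : `|x - y| < e / (`|z| + 1).
  by near: y; move/cvgrPdist_lt : Fx; apply.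
apply: (@le_lt_trans _ _ (`|x - y| * (`|z| + 1))).
  by rewrite ler_wpM2l// lerDl.
by rewrite -ltr_pdivlMr.
Unshelve. all: by end_near. Qed.
Arguments inner_cvgl {F FF} z {x} _.

Lemma inner_cvgr {F : set_system H} {FF : Filter F} z x :
  F --> x -> (fun y => inner z y) @ F --> inner z x.
Proof.
move=> Fx; apply/cvgrPdist_lt => e e0.
have h := (@cvgrPdist_lt _ _ _ F FF _ _).1 (inner_cvgl z Fx) e e0.
near=> y; rewrite -innerBr innerC norm_conjC innerBl.
by near: y; exact: h.
Unshelve. all: by end_near. Qed.
Arguments inner_cvgr {F FF} z {x} _.

End Inner.

Lemma cauchy_seq_cvg {R : realType} (V : completeNormedModType R[i]) (u : nat -> V) :
  (forall e, 0 < e -> exists n0, forall m n, (n0 <= m)%N -> (n0 <= n)%N ->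
     `|u m - u n| < e) -> cvg (u @ \oo).
Proof.
move=> uc; apply/cauchy_cvgP/cauchy_ballP => e e0.
have [n0 un0] := uc e e0.
exists (u @` [set n | (n0 <= n)%N], u @` [set n | (n0 <= n)%N]).
  by split; exists n0 => // n /= nn; exists n.
by move=> [_ _] [/= [m mn <-] [n nn <-]]; rewrite -ball_normE/=; exact: un0.
Qed.

(** A positive element of [R[i]] is real, so the archimedean property of [R] applies to its real
    part. *)
Lemma complex_archi {R : realType} (e : R[i]) : 0 < e ->
  exists n0, forall n, (n0 <= n)%N -> n.+1%:R^-1 < e.
Proof.
move=> e0; have eR : (complex.Re e)%:C%C = e by rewrite RRe_real// gtr0_real.
have Re0 : 0 < complex.Re e by rewrite -ltcR eR.
exists (Num.bound (complex.Re e)^-1) => n bn.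
rewrite -eR -(rmorph_nat (real_complex R)) -fmorphV ltcR.
rewrite invf_plt ?posrE ?ltr0n//.
apply: lt_le_trans (archi_boundP _) _; first by rewrite invr_ge0 ltW.
by rewrite ler_nat (leq_trans bn).
Qed.

Section Projection.
Context {R : realType} {H : hilbertType R}.

(** The subtracted multiple of [z] is the one nearest to [w], so the last term is the largest
    possible drop in squared norm along [z]. *)
Lemma norm_sub_proj (w z : H) : z != 0 ->
  `|w - (inner w z / `|z| ^+ 2) *: z| ^+ 2 =
  `|w| ^+ 2 - `|inner w z| ^+ 2 / `|z| ^+ 2.
Proof.
move=> z0; rewrite -inner_norm innerBl !innerBr innerZl !innerZr innerZl.
rewrite (innerC z w) !inner_norm.
set c := inner w z; set n := `|z| ^+ 2.
have n0 : n != 0 by rewrite expf_neq0// normr_eq0.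
have nr : n^* = n by rewrite conj_Creal// rpredX// normr_real.
have -> : (c / n)^* * (c / n * n) = (c / n)^* * c by rewrite divfK.
by rewrite opprB addrA subrK normCK mulrAC.
Qed.

(** Take [y] whose squared distance to [x] exceeds the infimum by less than [e ^+ 2]. Moving it
    along [z] stays in [K], so the drop computed in [norm_sub_proj] is below [e ^+ 2]. *)
Let quasi_projection (K : csubspace H) (x : H) (e : R[i]) : 0 < e ->
  exists2 y, cs_set K y &
    forall z, cs_set K z -> `|inner (x - y) z| <= e * `|z|.
Proof.
move=> e0.
pose A := [set complex.Re (`|x - y| ^+ 2) | y in cs_set K].
have reK (v : H) : (complex.Re (`|v| ^+ 2))%:C%C = `|v| ^+ 2.
  by rewrite RRe_real// ger0_real// exprn_ge0.
have lbA : lbound A 0.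
  by move=> _ [y _ <-]; rewrite -lecR reK exprn_ge0.
have infA : has_inf A.
  split; last by exists 0.
  by exists (complex.Re (`|x - 0| ^+ 2)); exists 0 => //; exact: cs_set0.
have eR : (complex.Re (e ^+ 2))%:C%C = e ^+ 2.
  by rewrite RRe_real// ger0_real// exprn_ge0// ltW.
have e20 : 0 < complex.Re (e ^+ 2) by rewrite -ltcR eR exprn_gt0.
have [_ [y Ky <-] yd] := inf_adherent e20 infA.
exists y => // z Kz.
have [->|z0] := eqVneq z 0; first by rewrite inner0r !normr0 mulr0.
have zz0 : 0 < `|z| by rewrite normr_gt0.
pose t := inner (x - y) z / `|z| ^+ 2.
have Ky' : cs_set K (t *: z + y) by exact: cs_setP.
have : inf A <= complex.Re (`|x - (t *: z + y)| ^+ 2).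
  by apply: (ge_inf infA.2); exists (t *: z + y).
have -> : x - (t *: z + y) = x - y - t *: z by rewrite opprD [- _ - _]addrC addrA.
rewrite -lecR => le1.
move: yd; rewrite -ltcR rmorphD/= reK eR => lt1.
have {le1 lt1} : `|x - y| ^+ 2 < `|x - y - t *: z| ^+ 2 + e ^+ 2.
  by apply: lt_le_trans lt1 _; rewrite lerD2r -reK.
rewrite norm_sub_proj// -addrA ltrDl addrC subr_gt0 => h.
rewrite -ler_sqr ?nnegrE ?mulr_ge0 ?(ltW e0)// exprMn -ler_pdivrMr ?exprn_gt0//.
exact: ltW.
Qed.

(** Quasi-projections with error 1 / (n + 1) form a Cauchy sequence: [y m - y n] lies in [K], so its
    squared norm is a difference of two nearly vanishing inner products. Orthogonality passes to the
    limit. *)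
Lemma projection (K : csubspace H) (x : H) :
  exists2 y, cs_set K y & forall z, cs_set K z -> inner (x - y) z = 0.
Proof.
have n0 n : 0 < (n.+1%:R^-1 : R[i]) by rewrite invr_gt0 ltr0n.
pose y n := sval (cid2 (quasi_projection K x (n0 n))).
have yK n : cs_set K (y n) by rewrite /y; case: cid2.
have yq n z : cs_set K z -> `|inner (x - y n) z| <= n.+1%:R^-1 * `|z|.
  by rewrite /y; case: cid2 => /= u _; exact.
have KB u v : cs_set K u -> cs_set K v -> cs_set K (v - u).
  by move=> Ku Kv; rewrite addrC -scaleN1r; exact: cs_setP.
have yd m n : `|y m - y n| <= m.+1%:R^-1 + n.+1%:R^-1.
  have [->|yy] := eqVneq (y m - y n) 0.
    by rewrite normr0 addr_ge0// ltW.
  rewrite -(@ler_pM2r _ `|y m - y n|) ?normr_gt0//.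
  have -> : `|y m - y n| * `|y m - y n| =
     `|inner (x - y n) (y m - y n) - inner (x - y m) (y m - y n)|.
    rewrite -innerBl [x - y n]addrC addrKA opprK addrC inner_norm.
    by rewrite ger0_norm ?exprn_ge0.
  apply: le_trans (ler_normB _ _) _.
  by rewrite mulrDl addrC lerD// yq//; exact: KB.
have yc : cvg (y @ \oo).
  apply: cauchy_seq_cvg => e e0.
  have [N hN] := @complex_archi R (e / 2) (divr_gt0 e0 (ltr0Sn _ _)).
  exists N => m n mN nN; apply: le_lt_trans (yd m n) _.
  by rewrite (splitr e) ltrD// hN.
exists (lim (y @ \oo)).
  by apply: (@closed_cvg _ _ _ _ y _ (cs_setC K) _ _ yc); exact: nearW.
move=> z Kz.
have c : (fun n => inner (y n) z) @ \oo --> inner (lim (y @ \oo)) z.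
  exact: (@inner_cvgl R H (y @ \oo) _ z _ yc).
apply/eqP; rewrite innerBl -normr_eq0 eq_le normr_ge0 andbT.
apply/ler_addgt0Pr => e e0; rewrite add0r.
have z0 : 0 < `|z| + 1 by rewrite ltr_wpDl.
have ez : 0 < e / 2 / (`|z| + 1) by rewrite !divr_gt0.
have [N hN] := complex_archi ez.
move/cvgrPdist_lt : c => /(_ (e / 2) (divr_gt0 e0 (ltr0Sn _ _))) [N' _ hN'].
pose n := maxn N N'.
have h1 := ltW (hN' n (leq_maxr _ _)).
have h2 : `|inner (x - y n) z| <= e / 2.
  apply: le_trans (yq n z Kz) _.
  apply: (@le_trans _ _ (n.+1%:R^-1 * (`|z| + 1))).
    by rewrite ler_wpM2l ?lerDl// ltW.
  by rewrite -ler_pdivlMr// ltW// hN// leq_maxl.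
rewrite (splitr e).
have -> : inner x z - inner (lim (y @ \oo)) z =
   inner (x - y n) z - (inner (lim (y @ \oo)) z - inner (y n) z).
  by rewrite innerBl opprB addrA subrK.
by apply: le_trans (ler_normB _ _) _; exact: lerD.
Qed.

End Projection.

(** * Bounded operators and adjoints *)

Section BoundedOps.
Context {R : realType} {H K L : hilbertType R}.
Implicit Types (S T : bop H K).

Lemma bop_zeroE x : (0 : bop H K) x = 0. Proof. by []. Qed.
Lemma bop_addE S T x : (S + T) x = S x + T x. Proof. by []. Qed.
Lemma bop_oppE S x : (- S) x = - S x. Proof. by []. Qed.
Lemma bop_scaleE (a : R[i]) S x : (a *: S) x = a *: S x. Proof. by []. Qed.
Lemma bop_compE (S : bop K L) T x : (S *o T) x = S (T x). Proof. by []. Qed.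
Lemma bop_idE (x : H) : bop_id H x = x. Proof. by []. Qed.
Lemma bop_subE S T x : (S - T) x = S x - T x. Proof. by []. Qed.

Definition bopE := (bop_subE, bop_addE, bop_oppE, bop_scaleE, bop_compE, bop_idE).

Lemma bopD T x y : T (x + y) = T x + T y. Proof. exact: linearD. Qed.
Lemma bopN T x : T (- x) = - T x. Proof. exact: linearN. Qed.
Lemma bopB T x y : T (x - y) = T x - T y. Proof. exact: linearB. Qed.
Lemma bop0 T : T 0 = 0. Proof. exact: linear0. Qed.

Lemma bop_bounded T : exists2 M : R[i], 0 < M & forall x, `|T x| <= M * `|x|.
Proof.
have /linear_bounded_continuous/linear_boundedP/pinfty_ex_gt0[M M0 hM] :=
  @bop_continuous R H K T.
by exists M.
Qed.

Lemma bounded_bop (f : H -> K) (M : R[i]) :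
  0 <= M -> linear f -> (forall x, `|f x| <= M * `|x|) -> exists T : bop H K, T =1 f.
Proof.
move=> M0 lf fM.
pose g : {linear H -> K} := HB.pack f (GRing.isLinear.Build _ _ _ _ f lf).
have cg : continuous g.
  apply/linear_bounded_continuous/linear_boundedP.
  near=> r => x; apply: le_trans (fM x) _; rewrite ler_wpM2r//.
  by near: r; apply: nbhs_pinfty_ge; exact: ger0_real.
by exists (mkbop cg).
Unshelve. all: by end_near. Qed.

End BoundedOps.

Section AdjointProjection.
Context {R : realType}.
Implicit Types H K L : hilbertType R.

(** [oproj] is a choice with default 0, so a bounded operator with this property has to be
    exhibited. Uniqueness of the projected point makes it linear, and Pythagoras bounds its norm by
    1. *)
Lemma oprojP H (K : csubspace H) (x : H) (y : K) :
  inner (x - incl_op K (oproj K x)) (incl_op K y) = 0.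
Proof.
suff [P hP] : exists P : bop H K, forall x (y : K),
    inner (x - incl_op K (P x)) (incl_op K y) = 0.
  by apply: (@xgetPex _ 0 [set P : bop H K | forall x (y : K),
    inner (x - incl_op K (P x)) (incl_op K y) = 0]); exists P.
pose p (x : H) := s2val (cid2 (projection K x)).
have pK x' : cs_set K (p x') by rewrite /p; case: cid2.
have pE x' z : cs_set K z -> inner (x' - p x') z = 0.
  by rewrite /p; case: cid2 => /= u _; exact.
pose P x' : K := CsElt (mem_set (pK x')).
have Pu (x' : H) (u : K) :
    (forall v : K, inner (x' - val u) (val v) = 0) -> P x' = u.
  move=> hu; apply: eq_inner => v.
  rewrite -[LHS]/(inner (p x') (val v)) -[RHS]/(inner (val u) (val v)).
  apply/eqP; rewrite -subr_eq0 -innerBl.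
  rewrite -[p x'](subKr x') addrAC innerBl hu pE ?subrr//.
  exact: set_mem (cs_valP v).
have PE x' (v : K) : inner (x' - val (P x')) (val v) = 0.
  by apply: pE; exact: set_mem (cs_valP v).
have [Q QP] : exists Q : bop H K, Q =1 P.
  apply: (@bounded_bop R H K P 1) => // [a u v|u].
    apply: Pu => w; rewrite -[val (_ + _)]/(a *: val (P u) + val (P v)).
    by rewrite opprD addrACA -scalerBr innerDl innerZl !PE mulr0 addr0.
  rewrite mul1r -ler_sqr ?nnegrE//.
  have -> : `|u| ^+ 2 = `|u - val (P u)| ^+ 2 + `|P u| ^+ 2.
    rewrite -[`|P u|]/(`|val (P u)|) -!inner_norm -(hnormDd _) ?subrK//.
    exact: PE.
  by rewrite lerDr exprn_ge0.
by exists Q => x' v; rewrite QP; exact: PE.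
Qed.

(** When the functional does not vanish, a vector [w] orthogonal to its closed kernel represents it
    up to a scalar. *)
Lemma riesz_op H K (T : bop H K) (y : K) :
  exists z, forall x, inner (T x) y = inner x z.
Proof.
have ker0 : inner (T 0) y = 0 by rewrite linear0 inner0l.
have kerP (a : R[i]) u v : inner (T u) y = 0 -> inner (T v) y = 0 ->
    inner (T (a *: u + v)) y = 0.
  by move=> u0 v0; rewrite linearP innerDl innerZl u0 v0 mulr0 addr0.
have kerC : closed [set x | inner (T x) y = 0].
  have -> : [set x | inner (T x) y = 0] = T @^-1` orthc_set [set y].
    apply/seteqP; split=> [x /= h _ ->//|x]; exact.
  apply: (@preimage_closed _ _ T); last exact: closed_orthc.
  by move=> x _; exact: bop_continuous.
pose N := CSubspace ker0 kerP kerC.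
have [all0|/existsNP[x0 x0N]] := pselect (forall x, inner (T x) y = 0).
  by exists 0 => x; rewrite all0 inner0r.
have [p Np pE] := projection N x0.
pose w := x0 - p.
have Tw : inner (T w) y != 0.
  by rewrite linearB innerBl (Np : inner (T p) y = 0) subr0; apply/eqP.
have w0 : inner w w != 0.
  by apply: contra_neq Tw => /inner_eq0 ->; rewrite linear0 inner0l.
(* The scalar is fixed by the case [x = w]; any other [x] differs from a multiple of [w] by an
   element of the kernel. *)
exists ((inner (T w) y / inner w w)^* *: w) => x.
have : inner w (x - (inner (T x) y / inner (T w) y) *: w) = 0.
  by apply: pE; rewrite /= linearB linearZ/= innerBl innerZl divfK ?subrr.
move/inner_sym0; rewrite innerBl innerZl => /eqP; rewrite subr_eq0 => /eqP xw.
rewrite innerZr xw conjCK; field.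
by rewrite w0 Tw.
Qed.

Lemma adjP H K (T : bop H K) x y : inner (T x) y = inner x (adj T y).
Proof.
suff [A hA] : exists A : bop K H, forall x y, inner (T x) y = inner x (A y).
  by apply: (@xgetPex _ 0 [set A : bop K H | forall x y,
    inner (T x) y = inner x (A y)]); exists A.
pose A v := sval (cid (riesz_op T v)).
have AE u v : inner (T u) v = inner u (A v) by rewrite /A; case: cid.
have [M M0 TM] := bop_bounded T.
have [Q QA] : exists Q : bop K H, Q =1 A.
  apply: (@bounded_bop R K H A M); first exact: ltW.
    move=> a u v; apply: eq_inner => z; rewrite innerC -AE [RHS]innerC.
    by rewrite !innerDr !innerZr !AE.
  move=> v; have [->|Av0] := eqVneq (A v) 0.
    by rewrite normr0 mulr_ge0// ltW.
  (* The squared norm of [A v] equals [inner (T (A v)) v], so the bound [M] of [T] carries over to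
     [A]. *)
  rewrite -(@ler_pM2r _ `|A v|) ?normr_gt0// -expr2 -inner_norm -AE.
  rewrite -[inner _ _]ger0_norm; last by rewrite AE inner_ge0.
  apply: le_trans (inner_le _ _) _.
  by rewrite mulrAC ler_wpM2r.
by exists Q => u v; rewrite QA.
Qed.

Lemma adjPr H K (T : bop H K) x y : inner x (T y) = inner (adj T x) y.
Proof. by rewrite innerC adjP -innerC. Qed.

Lemma adj_unique H K (T : bop H K) (A : bop K H) :
  (forall x y, inner (T x) y = inner x (A y)) -> adj T = A.
Proof.
move=> TA; apply/bopP => y; apply: eq_inner => x.
by rewrite -adjPr innerC TA -innerC.
Qed.

Lemma adjK H K (T : bop H K) : adj (adj T) = T.
Proof. by apply: adj_unique => x y; rewrite -adjPr. Qed.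

Lemma adj_contr H K (T : bop H K) :
  contractive T -> contractive (adj T).
Proof.
move=> T1 y; have [->|Ty] := eqVneq (adj T y) 0; first by rewrite normr0.
rewrite -(@ler_pM2r _ `|adj T y|) ?normr_gt0// -expr2 -inner_norm -adjP.
rewrite -[inner _ _]ger0_norm; last by rewrite adjP inner_ge0.
by apply: le_trans (inner_le _ _) _; rewrite mulrC ler_wpM2l.
Qed.

Section Decomposition.
Context {H : hilbertType R}.

Lemma inner_incl (K : csubspace H) (u v : K) :
  inner (incl_op K u) (incl_op K v) = inner u v.
Proof. by []. Qed.

Lemma inner_oprojl (K : csubspace H) x (y : K) :
  inner (oproj K x) y = inner x (incl_op K y).
Proof.
by apply/esym/eqP; rewrite -subr_eq0 -inner_incl -innerBl oprojP.
Qed.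

Lemma inner_oprojr (K : csubspace H) x (y : K) :
  inner y (oproj K x) = inner (incl_op K y) x.
Proof. by rewrite innerC inner_oprojl -innerC. Qed.

Lemma oproj_incl (K : csubspace H) (y : K) : oproj K (incl_op K y) = y.
Proof. by apply: eq_inner => z; rewrite inner_oprojl. Qed.

Lemma inner_orthc (K : csubspace H) (h : K) (n : orthc K) :
  inner (incl_op K h) (incl_op (orthc K) n) = 0.
Proof.
by apply: inner_sym0; apply: (set_mem (cs_valP n)); exact: set_mem (cs_valP h).
Qed.

Lemma oproj_decomp (K : csubspace H) x :
  incl_op K (oproj K x) + incl_op (orthc K) (oproj (orthc K) x) = x.
Proof.
have oK : x - incl_op K (oproj K x) \in cs_pred (orthc K).
  by apply: mem_set => y Ky; exact: (oprojP x (CsElt (mem_set Ky))).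
set n : orthc K := CsElt oK.
suff -> : oproj (orthc K) x = n by rewrite addrC subrK.
apply: eq_inner => z; rewrite inner_oprojl -inner_incl.
rewrite -[incl_op _ n]/(x - incl_op K (oproj K x)) innerBl inner_orthc.
by rewrite subr0.
Qed.

Lemma oproj_orthc_incl (K : csubspace H) (h : K) : oproj (orthc K) (incl_op K h) = 0.
Proof. by apply: eq_inner => z; rewrite inner_oprojl inner_orthc inner0l. Qed.

Lemma oproj_contr (K : csubspace H) : contractive (oproj K).
Proof.
move=> x; rewrite -ler_sqr ?nnegrE// -[in leRHS](oproj_decomp K x).
by rewrite -!inner_norm hnormDd/= ?inner_orthc// lerDl inner_ge0.
Qed.

End Decomposition.

End AdjointProjection.

(** * Nonnegative square roots *)

Section Nonneg.
Context {R : realType} {H : hilbertType R}.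
Implicit Types S T : bop H H.

Definition symmetric_op S := forall x y, inner (S x) y = inner x (S y).

Lemma inner_polarD S x y : inner (S (x + y)) (x + y) =
  inner (S x) x + inner (S y) y + (inner (S x) y + inner (S y) x).
Proof. by rewrite (linearD S) innerDl !innerDr; ring. Qed.

(** The form is real, hence so is the cross term [inner (S x) z + inner (S z) x]. Its reality at
    [z = y] and at [z = 'i *: y] together gives the symmetry. *)
Lemma nonneg_sym S : nonneg S -> symmetric_op S.
Proof.
move=> S0 x y; rewrite (innerC x).
have re z : (inner (S z) z)^* = inner (S z) z by rewrite conj_Creal// ger0_real.
have e z : inner (S x) z + inner (S z) x = (inner (S x) z + inner (S z) x)^*.
  have -> : inner (S x) z + inner (S z) x = inner (S (x + z)) (x + z) -
      inner (S x) x - inner (S z) z by rewrite inner_polarD; ring.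
  by rewrite !rmorphB/= !re.
have e1 := e y; have := e ('i *: y).
rewrite (linearZ_LR S) innerZr innerZl !rmorphD !rmorphM/= conjCK conjCi.
move: e1; rewrite rmorphD /=.
set a := inner (S x) y; set b := inner (S y) x => e1 e2.
have {}e2 : b - a = a^* - b^*.
  apply: (mulfI (neq0Ci _)).
  have -> : 'i * (b - a) = - 'i * a + 'i * b by ring.
  by rewrite e2; ring.
have -> : a = (a + b - (b - a)) / 2 by field.
by rewrite e1 e2; field.
Qed.

(** Expand the nonnegative form at [M *: x - S x], bound its term [inner (S (S x)) (S x)] by M |S
    x|^2, and divide by [M]. *)
Lemma nonneg_norm_le S (M : R[i]) : 0 < M -> nonneg S ->
  (forall x, `|S x| <= M * `|x|) -> forall x, `|S x| ^+ 2 <= M * inner (S x) x.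
Proof.
move=> M0 S0 SM x; have S1 := nonneg_sym S0.
have := S0 (M *: x - S x).
rewrite (linearB S) (linearZ_LR S) innerBl !innerBr !innerZl !innerZr.
rewrite conj_Creal ?gtr0_real// (S1 (S x) x) inner_norm => h.
have SS : inner (S (S x)) (S x) <= M * `|S x| ^+ 2.
  rewrite -[inner _ _]ger0_norm//; apply: le_trans (inner_le _ _) _.
  by rewrite expr2 mulrA ler_wpM2r.
rewrite -(ler_pM2l M0) -subr_ge0; apply: le_trans h _.
rewrite -subr_ge0.
have -> : M * (M * inner (S x) x) - M * `|S x| ^+ 2 -
  (M * (M * inner (S x) x) - M * `|S x| ^+ 2 -
   (M * `|S x| ^+ 2 - inner (S (S x)) (S x))) =
   M * `|S x| ^+ 2 - inner (S (S x)) (S x) by ring.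
by rewrite subr_ge0.
Qed.

Lemma nonneg_ker S x : nonneg S -> inner (S x) x = 0 -> S x = 0.
Proof.
move=> S0 Sx; have [M M0 SM] := bop_bounded S.
have := nonneg_norm_le M0 S0 SM x.
rewrite Sx mulr0 => h; apply/eqP; rewrite -normr_eq0 -sqrf_eq0.
by rewrite eq_le h exprn_ge0.
Qed.

Lemma bop_ext_form S T :
  (forall x, inner (S x) x = inner (T x) x) -> S = T.
Proof.
move=> ST; apply/bopP => x; apply/eqP; rewrite -subr_eq0; apply/eqP.
have D0 : forall y, inner ((S - T) y) y = 0.
  by move=> y; rewrite bopE innerBl ST subrr.
by apply: (@nonneg_ker (S - T)) => // y; rewrite D0.
Qed.

(** For [y = P x - Q x], commutation gives [P y + Q y = 0]. Both forms then vanish at [y], so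
    [P y = Q y = 0], and |y|^2 is zero by symmetry. *)
Lemma sqrt_unique S P Q : nonneg P -> nonneg Q -> P *o P = S -> Q *o Q = S ->
  P *o Q = Q *o P -> P = Q.
Proof.
move=> P0 Q0 PS QS PQ; apply/bopP => x; apply/eqP; rewrite -subr_eq0; apply/eqP.
have PPQ y : P (P y) = Q (Q y) by rewrite -!bop_compE PS QS.
have PQy y : P (Q y) = Q (P y) by rewrite -!bop_compE PQ.
set y := P x - Q x.
have y0 : P y + Q y = 0.
  by rewrite /y (linearB P) (linearB Q) /= PPQ PQy addrA subrK subrr.
have : inner (P y) y + inner (Q y) y = 0 by rewrite -innerDl y0 inner0l.
move/eqP; rewrite paddr_eq0 ?P0 ?Q0//.
move=> /andP[/eqP /(nonneg_ker P0) Py /eqP /(nonneg_ker Q0) Qy].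
apply: inner_eq0; rewrite -[in LHS]/y.
rewrite {2}/y innerBr -(nonneg_sym P0) -(nonneg_sym Q0) Py Qy.
by rewrite subrr.
Qed.

End Nonneg.

Section SqrtIteration.
Context {R : realType} {H : hilbertType R} (A : bop H H).
Hypothesis A_sym : symmetric_op A.
Hypothesis A_contr : contractive A.

Let X := fix X n : bop H H :=
  if n is m.+1 then 2^-1 *: (A + X m *o X m) else 0.

(** The same recursion with [A] replaced by 1. It increases within [0, 1] and dominates the norms of
    the [X n] and of their increments. *)
Let xi := fix xi n : R := if n is m.+1 then 2^-1 * (1 + xi m ^+ 2) else 0.

Let XS n x : X n.+1 x = 2^-1 *: (A x + X n (X n x)). Proof. by []. Qed.

Let xi_ge0 n : 0 <= xi n.
Proof. by elim: n => //= n IH; rewrite mulr_ge0 ?invr_ge0 ?addr_ge0 ?exprn_ge0. Qed.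

Let xi_le1 n : xi n <= 1.
Proof. by elim: n => //= n IH; have := xi_ge0 n; nra. Qed.

Let xi_leS n : xi n <= xi n.+1.
Proof. by have := xi_ge0 n; have := xi_le1 n; rewrite /=; nra. Qed.

(** Each [X n] is a polynomial in [A]. *)
Let X_comm (C : bop H H) n : (forall x, C (A x) = A (C x)) ->
  forall x, C (X n x) = X n (C x).
Proof.
move=> CA; elim: n => [|n IH] x; first by rewrite linear0.
by rewrite !XS (linearZ_LR C) (linearD C)/= CA !IH.
Qed.

Let XX_comm m n x : X m (X n x) = X n (X m x).
Proof. by apply: X_comm => y; apply/esym; exact: X_comm. Qed.

Let X_sym n : symmetric_op (X n).
Proof.
elim: n => [|n IH] x y; first by rewrite inner0l inner0r.
rewrite !XS innerZl innerZr innerDl innerDr A_sym !IH.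
by rewrite conj_Creal// realV realn.
Qed.

Let half_ge0 : 0 <= 2^-1 :> R[i]. Proof. by rewrite invr_ge0. Qed.

Let X_le n x : `|X n x| <= (xi n)%:C%C * `|x|.
Proof.
elim: n x => [|n IH] x; first by rewrite normr0 mul0r.
rewrite XS normrZ ger0_norm//= rmorphM/= fmorphV rmorph_nat -mulrA.
rewrite ler_wpM2l// rmorphD rmorph1 rmorphXn/= mulrDl mul1r.
apply: le_trans (ler_normD _ _) _; apply: lerD => //.
apply: le_trans (IH _) _; rewrite expr2 -mulrA ler_wpM2l//.
by rewrite ler0c.
Qed.

Let X_contr n : contractive (X n).
Proof.
move=> x; apply: le_trans (X_le n x) _.
by rewrite ler_piMl// lecR.
Qed.

(** Consecutive iterates commute, so the difference of their squares factors as sum times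
    difference, exactly as for [xi]. *)
Let X_leS n x : `|X n.+1 x - X n x| <= (xi n.+1 - xi n)%:C%C * `|x|.
Proof.
elim: n x => [|n IH] x.
  by rewrite !subr0; exact: X_le.
have -> : X n.+2 x - X n.+1 x =
    2^-1 *: ((X n.+1 + X n) (X n.+1 x - X n x)).
  transitivity (2^-1 *: (A x + X n.+1 (X n.+1 x)) - 2^-1 *: (A x + X n (X n x))).
    by [].
  rewrite -scalerBr; congr (_ *: _).
  move: (X n.+1) (X n) (XX_comm n.+1 n x) => Y Z YZ.
  by rewrite bopE (linearB Y) (linearB Z)/= YZ addrA subrK opprD addrACA subrr add0r.
rewrite normrZ ger0_norm//.
have -> : (xi n.+2 - xi n.+1)%:C%C =
    2^-1 * (((xi n.+1)%:C%C + (xi n)%:C%C) * (xi n.+1 - xi n)%:C%C).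
  rewrite -rmorphD -rmorphM -(rmorph_nat (real_complex R) 2) -fmorphV -rmorphM.
  by congr (_%:C)%C; rewrite /=; ring.
rewrite -mulrA ler_wpM2l// bopE; apply: le_trans (ler_normD _ _) _.
by rewrite -mulrA mulrDl; apply: lerD;
  apply: le_trans (X_le _ _) _; rewrite ler_wpM2l ?ler0c.
Qed.

Let xi_homo : {homo xi : m n / (m <= n)%N >-> m <= n}.
Proof. by apply: homo_leq => //; exact: le_trans. Qed.

Let X_le_dist m n x : (n <= m)%N ->
  `|X m x - X n x| <= (xi m - xi n)%:C%C * `|x|.
Proof.
move=> nm; rewrite -(subnK nm); elim: (m - n)%N => [|k IH].
  by rewrite !subrr normr0 mul0r.
rewrite addSn -(subrKA (X (k + n) x)) -(subrKA (xi (k + n))).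
rewrite rmorphD/= mulrDl; apply: le_trans (ler_normD _ _) _.
apply: lerD; [exact: X_leS|exact: IH].
Qed.

Let xi_cauchy (e : R) : 0 < e ->
  exists n0, forall m n, (n0 <= n)%N -> (n <= m)%N -> xi m - xi n < e.
Proof.
move=> e0.
have hs : has_sup (range xi).
  by split; [exists (xi 0), 0|exists 1 => _ [n _ <-]].
have [_ [n0 _ <-] hn] := sup_adherent e0 hs.
exists n0 => m n n0n nm.
have h1 : xi m <= sup (range xi) by apply: (ub_le_sup hs.2); exists m.
by have := xi_homo n0n; lra.
Qed.

Let X_cvg x : cvg (X ^~ x @ \oo).
Proof.
apply: cauchy_seq_cvg => e e0.
have x0 : 0 < `|x| + 1 by rewrite ltr_wpDl.
pose d := e / (`|x| + 1).
have d0 : 0 < d by rewrite divr_gt0.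
have dR : (complex.Re d)%:C%C = d by rewrite RRe_real// gtr0_real.
have Red : 0 < complex.Re d by rewrite -ltcR dR.
have [n0 hn] := xi_cauchy Red.
have key m n : (n0 <= n)%N -> (n <= m)%N -> `|X m x - X n x| < e.
  move=> n0n nm; apply: le_lt_trans (X_le_dist x nm) _.
  apply: (@le_lt_trans _ _ ((xi m - xi n)%:C%C * (`|x| + 1))).
    by rewrite ler_wpM2l ?lerDl// ler0c subr_ge0 xi_homo.
  by rewrite -ltr_pdivlMr// -/d -dR ltcR hn.
exists n0 => m n n0m n0n; have [nm|/ltnW mn] := leqP n m; first exact: key.
by rewrite distrC; exact: key.
Qed.

(** [Y] is the pointwise limit of the [X n]. The commutation clause later serves to identify the
    chosen square root with the constructed one. *)
Lemma sqrt_fixpoint : exists Y : bop H H,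
  [/\ contractive Y, symmetric_op Y, 2 *: Y = A + Y *o Y &
      forall C : bop H H, C *o A = A *o C -> C *o Y = Y *o C].
Proof.
pose f x := lim (X ^~ x @ \oo).
have fE x : X ^~ x @ \oo --> f x by exact: X_cvg.
have uniq (V : normedModType R[i]) (u : nat -> V) (a b : V) :
    u @ \oo --> a -> u @ \oo --> b -> a = b.
  by move=> ua ub; exact: (norm_cvg_unique ua ub).
have f_contr x : `|f x| <= `|x|.
  apply/ler_addgt0Pr => e e0.
  move/cvgrPdist_lt : (fE x) => /(_ e e0) [n _ /(_ n (leqnn n)) /= h].
  rewrite -(subrK (X n x) (f x)) addrC; apply: le_trans (ler_normD _ _) _.
  by apply: lerD; [exact: X_contr|exact: ltW].
have f_lin : linear f.
  move=> a x y; apply: uniq (fE _) _.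
  have -> : X^~ (a *: x + y) = (fun n => a *: X n x + X n y).
    by apply/funext => n; rewrite linearP.
  by apply: cvgD => //; exact: cvgZl_tmp.
have [Y Yf] : exists Y : bop H H, Y =1 f.
  by apply: (@bounded_bop R H H f 1) => // x; rewrite mul1r.
exists Y; split=> [x|x y||C CA].
- by rewrite Yf.
- have c1 : (fun n => inner (X n x) y) @ \oo --> inner (f x) y.
    exact: (@inner_cvgl R H (X^~ x @ \oo) _ y _ (fE x)).
  have c2 : (fun n => inner (X n x) y) @ \oo --> inner x (f y).
    rewrite (_ : (fun _ => _) = fun n => inner x (X n y)).
      exact: (@inner_cvgr R H (X^~ y @ \oo) _ x _ (fE y)).
    by apply/funext => n; rewrite X_sym.
  by rewrite !Yf; exact: (uniq R[i]^o _ _ _ c1 c2).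
- apply/bopP => x; rewrite !bopE !Yf.
  (* Compare through [X n (f x)]: as [X n] is a contraction, the second difference is at most |f x -
     X n x|. *)
  have XX : (fun n => X n (X n x)) @ \oo --> f (f x).
    apply/cvgrPdist_lt => e e0; near=> n.
    rewrite -(subrKA (X n (f x))) (splitr e).
    apply: le_lt_trans (ler_normD _ _) _; apply: ltrD.
      near: n; move/cvgrPdist_lt : (fE (f x)); apply; exact: divr_gt0.
    rewrite -(linearB (X n)); apply: le_lt_trans (X_contr _ _) _.
    near: n; move/cvgrPdist_lt : (fE x); apply; exact: divr_gt0.
  have XS2 : (fun n => X n.+1 x) @ \oo --> 2^-1 *: (A x + f (f x)).
    by apply: cvgZl_tmp; apply: cvgD => //; exact: cvg_cst.
  have fx : f x = 2^-1 *: (A x + f (f x)).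
    by apply: uniq XS2;
      exact: (@cvg_comp _ _ _ _ (X^~ x) _ _ _ (cvg_addnl 1) (fE x)).
  by rewrite {1}fx scalerA mulfV ?pnatr_eq0// scale1r.
- apply/bopP => x; rewrite !bopE !Yf; apply: uniq (fE _).
  have -> : X^~ (C x) = C \o X^~ x.
    by apply/funext => n /=; rewrite X_comm// => y; rewrite -!bop_compE CA.
  by apply: (continuous_cvg _ _ (fE x)); exact: bop_continuous.
Unshelve. all: by end_near. Qed.

End SqrtIteration.

Section SquareRoot.
Context {R : realType}.
Implicit Types H K : hilbertType R.

(** [nonneg_norm_le] makes [A] a contraction, and the fixed point equation reads (I - Y)^2 = I - A =
    S / M. *)
Lemma sqrt_exists H (S : bop H H) : nonneg S -> exists Q : bop H H,
  [/\ nonneg Q, Q *o Q = S & forall C : bop H H, C *o S = S *o C -> C *o Q = Q *o C].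
Proof.
move=> S0; have [M M0 SM] := bop_bounded S.
have Mr : M^* = M by rewrite conj_Creal// gtr0_real.
have S1 := nonneg_sym S0; have Mn0 : M != 0 by rewrite gt_eqF.
pose A := bop_id H - M^-1 *: S.
have A_sym : symmetric_op A.
  move=> x y; rewrite !bopE innerBl innerBr innerZl innerZr S1.
  by rewrite fmorphV/= Mr.
have A_contr : contractive A.
  move=> x; rewrite -ler_sqr ?nnegrE// -!inner_norm !bopE.
  rewrite innerBl !innerBr !innerZl !innerZr fmorphV/= Mr -(S1 x x) inner_norm.
  have h := nonneg_norm_le M0 S0 SM x.
  rewrite -subr_ge0.
  set a := inner (S x) x in h *; rewrite inner_norm.
  have -> : `|x| ^+ 2 -
      (`|x| ^+ 2 - M^-1 * a - (M^-1 * a - M^-1 * (M^-1 * `|S x| ^+ 2))) =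
     M^-1 * a + M^-1 ^+ 2 * (M * a - `|S x| ^+ 2) by field.
  by rewrite addr_ge0 ?mulr_ge0 ?exprn_ge0 ?invr_ge0 ?(ltW M0) ?S0 ?subr_ge0.
have [Y [Y_contr Y_sym YE Y_comm]] := sqrt_fixpoint A_sym A_contr.
pose r := sqrtC M.
have r0 : 0 <= r by rewrite sqrtC_ge0 ltW.
have rr : r * r = M by rewrite -expr2 sqrtCK.
exists (r *: (bop_id H - Y)); split=> [x||C CS].
- rewrite !bopE innerZl mulr_ge0// innerBl inner_norm subr_ge0.
  apply: le_trans (real_ler_norm _) _.
    by rewrite CrealE; apply/eqP; rewrite -innerC Y_sym.
  apply: le_trans (inner_le _ _) _; rewrite expr2 ler_wpM2r//.
- apply/bopP => x; have /(congr1 (fun T : bop H H => T x)) := YE.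
  rewrite !bopE (linearZ_LR Y) (linearB Y)/= -scalerBr scalerA rr => e.
  have -> : x - Y x - (Y x - Y (Y x)) = x - (2 *: Y x - Y (Y x)).
    by rewrite scaler_nat mulr2n -addrA -opprD [_ + (_ - _)]addrA.
  rewrite e addrK opprB addrC subrK scalerA mulfV// scale1r//.
- apply/bopP => x; rewrite !bopE (linearZ_LR C) (linearB C)/=.
  have CA : C *o A = A *o C.
    apply/bopP => y; rewrite !bopE (linearB C) (linearZ_LR C)/=.
    by rewrite -!bop_compE CS.
  by rewrite -!(bop_compE C Y) Y_comm.
Qed.

(** The chosen root commutes with its own square [S], hence with the constructed root [Q], and
    [sqrt_unique] makes the two equal. *)
Lemma op_sqrtP H (S : bop H H) : nonneg S ->
  [/\ nonneg (op_sqrt S), op_sqrt S *o op_sqrt S = S &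
     forall C : bop H H, C *o S = S *o C -> C *o op_sqrt S = op_sqrt S *o C].
Proof.
move=> S0; have [Q [Q0 QS Q_comm]] := sqrt_exists S0.
have [P0 PS] : nonneg (op_sqrt S) /\ op_sqrt S *o op_sqrt S = S.
  by apply: (@xgetPex _ 0 [set Q : bop H H | nonneg Q /\ Q *o Q = S]); exists Q.
suff -> : op_sqrt S = Q by [].
apply: (sqrt_unique P0 Q0 PS QS); apply: Q_comm.
have PSx x : S x = op_sqrt S (op_sqrt S x) by rewrite -bop_compE PS.
by apply/bopP => x; rewrite !bopE !PSx.
Qed.

Lemma defectP H K (T : bop H K) : contractive T ->
  [/\ nonneg (defect T), defect T *o defect T = bop_id H - adj T *o T &
     forall C : bop H H, C *o (adj T *o T) = adj T *o T *o C ->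
       C *o defect T = defect T *o C].
Proof.
move=> T1; have D0 : nonneg (bop_id H - adj T *o T).
  move=> x; rewrite !bopE innerBl -adjPr !inner_norm subr_ge0.
  by rewrite ler_sqr ?nnegrE.
have [P0 PS PC] := op_sqrtP D0; split=> // C CT; apply: PC.
apply/bopP => x; rewrite !bopE (linearB C)/=.
by have /(congr1 (fun T : bop H H => T x)) := CT; rewrite !bopE => ->.
Qed.

End SquareRoot.

(** * Shorted operators *)

Section ShortedOperator.
Context {R : realType} {H : hilbertType R}.
Implicit Types (S T W Z : bop H H) (K : csubspace H).

Lemma op_leP S T : op_le S T <-> forall x, inner (S x) x <= inner (T x) x.
Proof.
split=> ST x; first by have := ST x; rewrite bopE innerBl subr_ge0.
by rewrite bopE innerBl subr_ge0.
Qed.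

Lemma op_le_anti S T : op_le S T -> op_le T S -> S = T.
Proof.
move=> /op_leP ST /op_leP TS; apply: bop_ext_form => x.
by apply/eqP; rewrite eq_le ST TS.
Qed.

Lemma closure_approx (A : set H) x (e : R[i]) : closure A x -> 0 < e ->
  exists2 a, A a & `|x - a| < e.
Proof.
move=> Ax e0; have [a [Aa]] := Ax _ (nbhsx_ballx x e e0).
by rewrite -ball_normE/= => xa; exists a.
Qed.

Lemma orthc_orthc K x : (forall y, orthc_set (cs_set K) y -> inner x y = 0) ->
  cs_set K x.
Proof.
move=> xo; have := oproj_decomp K x; set h := oproj K x; set n := oproj _ x.
have n0 : incl_op (orthc K) n = 0.
  apply: inner_eq0; have := xo _ (set_mem (cs_valP n)).
  rewrite -{1}(oproj_decomp K x) -/h -/n innerDl.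
  by rewrite inner_orthc add0r.
by rewrite n0 addr0 => <-; exact: set_mem (cs_valP h).
Qed.

(** A symmetric operator vanishes on the orthogonal complement of its range. *)
Lemma short_class_ker S K Z x : short_class S K Z -> orthc_set (cs_set K) x ->
  Z x = 0.
Proof.
move=> [Z0 _ ZK] Kx; apply: eq_inner => z; rewrite inner0l.
have Z1 : nonneg Z by move=> y; have := Z0 y; rewrite subr0.
by rewrite (nonneg_sym Z1); apply: Kx; exact: ZK.
Qed.

Lemma short_class_shift S K Z f x : short_class S K Z ->
  orthc_set (cs_set K) x -> inner (Z (f + x)) (f + x) = inner (Z f) f.
Proof.
move=> SZ Kx; rewrite (linearD Z)/= (short_class_ker SZ Kx) addr0 innerDr.
have [_ _ ZK] := SZ.
by rewrite (inner_sym0 (Kx _ (ZK f))) addr0.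
Qed.

(** The half of the infimum formula that asserts approximate attainment. For [W] in
    [short_class S K] the other half is automatic, because the form of [W] is constant on cosets of
    the complement of [K]. *)
Definition almost_inf S K W := forall f (e : R[i]), 0 < e ->
  exists2 x, orthc_set (cs_set K) x &
    inner (S (f + x)) (f + x) <= inner (W f) f + e.

(** A competitor has a form below that of [S] and constant along the complement of [K], so it stays
    below the infimum, which is the form of [W]. *)
Lemma shortedE S K W : short_class S K W -> almost_inf S K W -> shorted S K = W.
Proof.
move=> SW Winf.
have Wmax Z : short_class S K Z -> op_le Z W.
  move=> SZ; apply/op_leP => f; apply/ler_addgt0Pr => e e0.
  have [x Kx xe] := Winf f e e0.
  rewrite -(short_class_shift f SZ Kx); apply: le_trans xe.
  by have [_ /op_leP ZS _] := SZ.
have [SV Vmax] : short_class S K (shorted S K) /\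
    forall Z, short_class S K Z -> op_le Z (shorted S K).
  by apply: (@xgetPex _ 0 [set Z | short_class S K Z /\
    forall Z', short_class S K Z' -> op_le Z' Z]); exists W.
by apply: op_le_anti; [exact: Wmax|exact: Vmax].
Qed.

(** The form of [S] at [x] is |Q x|^2, so its infimum over [f] plus the complement of [K] is the
    squared distance from [Q f] to [C], that is |P (Q f)|^2. *)
Lemma shorted_exists S K : nonneg S ->
  exists2 W, short_class S K W & almost_inf S K W.
Proof.
move=> S0; have [Q [Q0 QS _]] := sqrt_exists S0; have Q1 := nonneg_sym Q0.
have SE x : inner (S x) x = inner (Q x) (Q x) by rewrite -QS bopE Q1.
pose C := closed_range (Q *o incl_op (orthc K)).
pose P := incl_op (orthc C) *o oproj (orthc C).
have WE x : inner ((Q *o P *o Q) x) x = `|P (Q x)| ^+ 2.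
  by rewrite !bopE Q1 -inner_oprojr inner_norm.
have QP x : `|Q x| ^+ 2 = `|oproj C (Q x)| ^+ 2 + `|P (Q x)| ^+ 2.
  rewrite -[in LHS](oproj_decomp C (Q x)) -!inner_norm.
  by rewrite hnormDd//= inner_orthc.
exists (Q *o P *o Q).
  split=> [||f].
  - by apply/op_leP => x; rewrite WE inner0l exprn_ge0.
  - by apply/op_leP => x; rewrite WE SE inner_norm QP lerDr exprn_ge0.
  (* For [y] orthogonal to [K], [Q y] lies in [C], which is orthogonal to the range of [P]. *)
  - apply: orthc_orthc => y Ky; rewrite !bopE Q1.
    apply: (set_mem (cs_valP (oproj (orthc C) (Q f)))).
    by apply: subset_closure; exists (@CsElt R H (orthc K) y (mem_set Ky)).
move=> f e e0.
have d0 : 0 < sqrtC e by rewrite sqrtC_gt0.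
(* The excess over the infimum will be the squared distance from [Q x] to the projection of [Q f] on
   [C], whence the tolerance [sqrtC e]. *)
have [_ [x _ <-] xd] := closure_approx (set_mem (cs_valP (oproj C (Q f)))) d0.
pose y := incl_op (orthc K) x.
exists (- y).
  by move=> z Kz; rewrite innerNl (set_mem (cs_valP x) z Kz) oppr0.
rewrite WE SE (linearB Q)/=.
rewrite -{1 2}(oproj_decomp C (Q f)) -[incl_op (orthc C) _]/(P (Q f)).
set u := incl_op C _; set v := P (Q f).
rewrite addrAC hnormDd/=.
  rewrite !inner_norm -[cs_incl _]/v [X in X <= _]addrC lerD2l.
  rewrite -[X in _ <= X](sqrtCK e) ler_sqr ?nnegrE// ?(ltW d0)//.
  exact: ltW xd.
have vC z : cs_set C z -> inner z v = 0.
  by move=> Cz; exact: (inner_orthc (CsElt (mem_set Cz))).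
rewrite innerBl !vC ?subrr//.
  by apply: subset_closure; exists x.
exact: set_mem (cs_valP _).
Qed.

Lemma shortedP S K : nonneg S ->
  short_class S K (shorted S K) /\ almost_inf S K (shorted S K).
Proof. by move=> /(shorted_exists K)[W SW Winf]; rewrite (shortedE SW Winf). Qed.

End ShortedOperator.

Section Contractions.
Context {R : realType} {H : hilbertType R} (A : bop H H).
Hypotheses (A_sym : symmetric_op A) (A_contr : contractive A).

Lemma inner_contr_le x : `|inner (A x) x| <= inner x x.
Proof.
apply: le_trans (inner_le _ _) _.
by rewrite inner_norm expr2 ler_wpM2r.
Qed.

Lemma inner_sym_real x : inner (A x) x \is Num.real.
Proof. by rewrite CrealE -innerC A_sym. Qed.

Lemma nonneg_id_sub : nonneg (bop_id H - A).
Proof.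
move=> x; rewrite !bopE innerBl subr_ge0.
exact: le_trans (real_ler_norm (inner_sym_real x)) (inner_contr_le x).
Qed.

Lemma nonneg_id_add : nonneg (bop_id H + A).
Proof.
move=> x; rewrite !bopE innerDl -[inner (A x) x]opprK subr_ge0.
apply: le_trans (real_ler_norm _) _; first by rewrite realN inner_sym_real.
by rewrite normrN inner_contr_le.
Qed.

End Contractions.

(** * The quadratic form of [I + B_X] *)

Section CrossForm.
Context {R : realType} {H : hilbertType R} (A D : bop H H).

(** The form at (h, k) of the block operator with rows (I + A, D) and (D, I - A). *)
Definition cross_form h k : R[i] :=
  inner (h + A h) h + inner (D k) h + inner (D h) k + inner (k - A k) k.

Hypotheses (A_sym : symmetric_op A) (A_contr : contractive A).
Hypotheses (D_sym : symmetric_op D) (DA : D *o A = A *o D).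
Hypothesis DD : D *o D = bop_id H - A *o A.

Let DAE x : D (A x) = A (D x). Proof. by rewrite -!bop_compE DA. Qed.
Let DDE x : D (D x) = x - A (A x). Proof. by rewrite -!bop_compE DD. Qed.

(** As D^2 = (I - A)(I + A) and [D] commutes with [A], the block operator annihilates the pair (-(I
    - A) g, D g), which can therefore be subtracted from the argument. *)
Lemma cross_form_shift h g d :
  cross_form h (D g + d) = cross_form (h + (g - A g)) d.
Proof.
rewrite /cross_form !(bopD, bopN, DDE).
rewrite !(innerDl, innerDr, innerNl, innerNr).
rewrite -!A_sym -!D_sym !DAE !DDE !(bopD, bopN) !(innerDl, innerNl).
ring.
Qed.

(* [w = h + (g - A g)] is unbounded as [D g] approaches a point of the closure, so
   the cross term has to be absorbed in squares instead of estimated. *)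
Lemma cross_form_sos w d : cross_form w d + 2 * `|d| ^+ 2 =
  2^-1 * (`|D w + 2 *: d| ^+ 2 + `|w + A w| ^+ 2) + inner (d - A d) d.
Proof.
rewrite -!inner_norm /cross_form.
rewrite !(innerDl, innerDr, innerNl, innerNr, innerZl, innerZr).
rewrite -!A_sym -!D_sym !DDE !(innerDl, innerNl).
by rewrite conj_Creal ?realn//; field.
Qed.

Let range_approx k (e : R[i]) : closure (range D) k -> 0 < e ->
  exists g d, k = D g + d /\ 2 * `|d| ^+ 2 <= e.
Proof.
move=> Dk e0.
have d0 : 0 < sqrtC (e / 2) by rewrite sqrtC_gt0 divr_gt0.
have [_ [g _ <-] kd] := closure_approx Dk d0.
exists g, (k - D g); rewrite addrC subrK; split=> //.
rewrite mulrC -ler_pdivlMr// -[X in _ <= X]sqrtCK ler_sqr ?nnegrE// ?(ltW d0)//.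
exact: ltW.
Qed.

(** Shift away [D g] and keep a small remainder [d]. By [cross_form_sos] and I - A >= 0 the form is
    at least -2 |d|^2, whatever [w] is. *)
Lemma cross_form_ge0 h k : closure (range D) k -> 0 <= cross_form h k.
Proof.
move=> Dk; apply/ler_addgt0Pr => e e0.
have [g [d [-> de]]] := range_approx Dk e0.
rewrite cross_form_shift; set w := h + _.
apply: (@le_trans _ _ (cross_form w d + 2 * `|d| ^+ 2)); last by rewrite lerD2l.
rewrite cross_form_sos addr_ge0//; last exact: (nonneg_id_sub A_sym A_contr d).
by rewrite mulr_ge0 ?invr_ge0// addr_ge0// exprn_ge0.
Qed.

Lemma cross_form_inf k (e : R[i]) : closure (range D) k -> 0 < e ->
  exists h, cross_form h k <= e.
Proof.
move=> Dk e0; have [g [d [-> de]]] := range_approx Dk e0.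
(* This choice makes the shifted first argument zero, which leaves ((I - A) d, d) <= 2 |d|^2. *)
exists (- (g - A g)); rewrite cross_form_shift addNr.
rewrite /cross_form !bop0 addr0 !inner0l inner0r !add0r.
apply: le_trans de; rewrite innerBl -(inner_norm d) mulr_natl mulr2n lerD2l.
apply: le_trans (real_ler_norm _) _.
  by rewrite realN inner_sym_real.
by rewrite normrN inner_contr_le.
Qed.

End CrossForm.

Section HsumInner.
Context {R : realType} {H K : hilbertType R}.

Lemma inner_inl (x : H) (u : hsum H K) : inner (inl_op H K x) u = inner x u.1.
Proof.
by rewrite -[LHS]/(inner x u.1 + inner 0 u.2) inner0l addr0.
Qed.

Lemma inner_inr (y : K) (u : hsum H K) : inner (inr_op H K y) u = inner y u.2.
Proof.
by rewrite -[LHS]/(inner 0 u.1 + inner y u.2) inner0l add0r.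
Qed.

Lemma inner_hsum (u v : hsum H K) : inner u v = inner u.1 v.1 + inner u.2 v.2.
Proof. by []. Qed.

Lemma inner_block_sum (X11 : bop H H) (X12 : bop K H) (X22 : bop K K)
    (u : hsum H K) :
  inner (block_sum X11 X12 (adj X12) X22 u) u =
  inner (X11 u.1) u.1 + inner (X12 u.2) u.1 +
  inner (adj X12 u.1) u.2 + inner (X22 u.2) u.2.
Proof. by rewrite !bopE !innerDl !inner_inl !inner_inr. Qed.

End HsumInner.

(** * Shorting a form that splits off a part with infimum zero *)

Section ShortedFactor.
Context {R : realType} {H L : hilbertType R} {H0 : csubspace H}.
Let N := orthc H0.
Variables (T : bop (hsum H L) (hsum H L)) (S : bop (hsum N L) (hsum N L)).
Variables (D : bop N N) (C : bop N H0) (q : H0 -> H0 -> R[i]).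
Hypotheses (S0 : nonneg S) (D_sym : symmetric_op D).
Hypothesis q_ge0 : forall h n, 0 <= q h (C n).
Hypothesis q_inf : forall n (e : R[i]), 0 < e -> exists h, q h (C n) <= e.
Hypothesis TE : forall u : hsum H L,
  let n := oproj N u.1 in let v : hsum N L := (D n, u.2) in
  inner (T u) u = q (oproj H0 u.1) (C n) + inner (S v) v.

Let Sh := shorted S (suml_csubspace L (full_csubspace N)).
Let Y : bop N N := restr Sh.
Let W := inl_op H L *o (incl_op N *o (D *o Y *o D) *o oproj N) *o fst_op H L.

(** The second summand is orthogonal to the subspace to which [S] is shorted, so the shorted form
    ignores [l]. *)
Let Sh_form (m : N) (l : L) :
  inner (Sh ((m, l) : hsum N L)) ((m, l) : hsum N L) = inner (Y m) m.
Proof.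
have [ShS _] := shortedP (suml_csubspace L (full_csubspace N)) S0.
have ml : (m, l) = inl_op N L m + inr_op N L l :> hsum N L.
  by rewrite -[RHS]/((m + 0, 0 + l) : hsum N L) addr0 add0r.
rewrite ml (short_class_shift _ ShS).
  by rewrite inner_hsum inner0r addr0.
by move=> z [_ z2]; rewrite inner_inr z2 inner0r.
Qed.

Let W_form (u : hsum H L) :
  inner (W u) u = inner (Y (D (oproj N u.1))) (D (oproj N u.1)).
Proof. by rewrite !bopE inner_inl -inner_oprojr D_sym. Qed.

(** [q] is nonnegative with infimum 0 in its first argument, and the H_0 and [L] components vary
    independently, so the infimum is the shorted form of [S] at [D n]. Leaving [q], [S] and [T]
    abstract covers both signs. *)
Lemma shorted_factor :
  shorted T (suml_csubspace L (orthc H0)) =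
  inl_op H L *o (incl_op (orthc H0) *o
    (D *o restr (shorted S (suml_csubspace L (full_csubspace (orthc H0)))) *o D) *o
    oproj (orthc H0)) *o fst_op H L.
Proof.
have [[/op_leP Sh0 /op_leP ShS _] Sh_inf] :=
  shortedP (suml_csubspace L (full_csubspace N)) S0.
apply: shortedE.
  split.
  - apply/op_leP => u; rewrite W_form -(Sh_form _ 0) inner0l.
    by have := Sh0 (D (oproj N u.1), 0); rewrite inner0l.
  - apply/op_leP => u; rewrite W_form -(Sh_form _ u.2) TE.
    by apply: le_trans (ShS _) _; rewrite lerDr.
  - by move=> u; split=> //; exact: set_mem (cs_valP _).
move=> u e e0; have e2 : 0 < e / 2 by rewrite divr_gt0.
set n := oproj N u.1.
have [[p l] pl0 pl] := Sh_inf ((D n, u.2) : hsum N L) _ e2.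
(* The shift for [S] is orthogonal to the first summand, so only [l] can move. *)
have p0 : p = 0.
  apply: inner_eq0; have := pl0 ((p, 0) : hsum N L) (conj I erefl).
  by rewrite inner_hsum/= inner0r addr0.
have [h hn] := q_inf n e2.
(* Adding this vector replaces the H_0 component of [u] by [h] and keeps its N component. *)
exists ((incl_op H0 (h - oproj H0 u.1), l) : hsum H L).
  move=> z [z1 z2]; rewrite inner_hsum/= z2 inner0r addr0.
  exact: (inner_orthc (h - oproj H0 u.1) (@CsElt R H (orthc H0) z.1 (mem_set z1))).
rewrite TE W_form -/n -(Sh_form _ u.2).
have -> : oproj H0 (u + (incl_op H0 (h - oproj H0 u.1), l)).1 = h.
  by rewrite bopD oproj_incl addrC subrK.
have -> : oproj N (u + (incl_op H0 (h - oproj H0 u.1), l)).1 = n.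
  by rewrite bopD oproj_orthc_incl addr0.
have <- : ((D n, u.2) : hsum N L) + (p, l) = (D n, u.2 + l).
  by rewrite p0 -[LHS]/((D n + 0, u.2 + l) : hsum N L) addr0.
by apply: le_trans (lerD hn pl) _; rewrite addrCA [in leRHS](splitr e).
Qed.

End ShortedFactor.

(** * Shorted operators of I + B_X and I - B_X *)

Section Extension.
Context {R : realType} {H L : hilbertType R} {H0 : csubspace H}.
Let N := orthc H0.
Variables (B : bop H0 H) (K0 : bop (defect_space (B_0 B)) N).
Hypotheses (B_contr : contractive B) (B_herm : hermitian_op B).
Hypothesis K0_contr : contractive K0.

Lemma B_0_contr : contractive (B_0 B).
Proof. by move=> h; apply: le_trans (oproj_contr _ _) (B_contr h). Qed.

Lemma B_0_sym : symmetric_op (B_0 B).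
Proof. by move=> h g; rewrite /B_0 bopE inner_oprojl B_herm -inner_oprojr. Qed.

Lemma adj_B_0 : adj (B_0 B) = B_0 B.
Proof. by apply: adj_unique; exact: B_0_sym. Qed.

Let D := defect (B_0 B).
Let Dn := D_K0s K0.
(** K_0^* with values read in H_0. They lie in the closure of the range of [D], where the cross form
    is controlled. *)
Let C : bop N H0 := incl_op (defect_space (B_0 B)) *o adj K0.

Let D_sym : symmetric_op D.
Proof. by have [/nonneg_sym] := defectP B_0_contr. Qed.

Let D_comm : D *o B_0 B = B_0 B *o D.
Proof.
have [_ _ DC] := defectP B_0_contr.
by rewrite DC// adj_B_0; apply/bopP.
Qed.

Let D_sqr : D *o D = bop_id H0 - B_0 B *o B_0 B.
Proof. by have [_ DD _] := defectP B_0_contr; rewrite /D DD adj_B_0. Qed.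

Let Dn_sym : symmetric_op Dn.
Proof. by have [/nonneg_sym] := defectP (adj_contr K0_contr). Qed.

Let Dn_sqr n : inner (Dn n) (Dn n) + inner (C n) (C n) = inner n n.
Proof.
have [_ DD _] := defectP (adj_contr K0_contr).
rewrite -Dn_sym -(bop_compE Dn Dn) /Dn /D_K0s DD adjK !bopE innerBl.
rewrite -[inner (C n) (C n)]/(inner (adj K0 n) (adj K0 n)).
by rewrite (adjP K0) subrK.
Qed.

Let C_closure n : closure (range D) (C n).
Proof. exact: set_mem (cs_valP (adj K0 n)). Qed.

Variables (X11 : bop N N) (X12 : bop L N) (X22 : bop L L).
Let X := block_sum X11 X12 (adj X12) X22.
Let BX := B_tilde K0 X11 X12 X22.

(** Moving [K0] and D_{K_0^*} across the inner product turns every entry with [K0] into a term in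
    [h] and [C n], and collects the entries of [X] into its form at [v]. *)
Let inner_B_tilde (u : hsum H L) :
  let h := oproj H0 u.1 in let n := oproj N u.1 in
  let v : hsum N L := (Dn n, u.2) in
  inner (BX u) u = inner (B_0 B h) h + inner (D (C n)) h + inner (D h) (C n) -
    inner (B_0 B (C n)) (C n) + inner (X v) v.
Proof.
move=> h n v.
have KD_form : inner (K0 (defect_cor (B_0 B) h)) n = inner (D h) (C n).
  by rewrite adjP.
(* The projection onto the defect space drops out because it is paired with [adj K0 n], which lies
   in that space. *)
have KBK_form : inner (KBK K0 n) n = inner (B_0 B (C n)) (C n).
  by rewrite /KBK !bop_compE adjP inner_oprojl.
have -> := inner_block_sum X11 X12 X22 v.
rewrite /BX /B_tilde /block3.
rewrite !bop_addE !innerDl.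
rewrite !bop_compE !inner_inl !inner_inr -[fst_op H L u]/u.1 -[snd_op H L u]/u.2.
rewrite -!inner_oprojr -/h -/n !bop_zeroE !inner0l.
rewrite bop_addE bop_oppE innerDl innerNl KBK_form KD_form.
rewrite !bop_compE !(Dn_sym _ n).
ring.
Qed.

Let inner_id (u : hsum H L) :
  let h := oproj H0 u.1 in let n := oproj N u.1 in
  let v : hsum N L := (Dn n, u.2) in
  inner u u = inner h h + inner (C n) (C n) + inner v v.
Proof.
move=> h n v; rewrite !inner_hsum/= addrA -[_ + inner (Dn n) _]addrA.
rewrite [inner (C n) _ + _]addrC Dn_sqr; congr (_ + _).
by rewrite -[in LHS](oproj_decomp H0 u.1) hnormDd/= ?inner_orthc.
Qed.

Hypotheses (X_selfadj : adj X = X) (X_contr : contractive X).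

Let X_sym : symmetric_op X.
Proof. by move=> x y; rewrite adjP X_selfadj. Qed.

Lemma shorted_id_add :
  shorted (bop_id (hsum H L) + BX) (suml_csubspace L N) =
  inl_op H L *o (incl_op N *o
    (Dn *o restr (shorted (bop_id (hsum N L) + X)
      (suml_csubspace L (full_csubspace N))) *o Dn) *o oproj N) *o fst_op H L.
Proof.
apply: (@shorted_factor _ _ _ _ _ _ _ C (cross_form (B_0 B) D)).
- exact: (nonneg_id_add X_sym X_contr).
- exact: Dn_sym.
- move=> h n; apply: (cross_form_ge0 B_0_sym B_0_contr D_sym D_comm D_sqr).
  exact: C_closure.
- move=> n e e0; apply: (cross_form_inf B_0_sym B_0_contr D_sym D_comm D_sqr) e0.
  exact: C_closure.
- move=> u n v; rewrite (bop_addE _ BX) (bop_addE _ X) !bop_idE.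
  rewrite (innerDl u (BX u)) (innerDl v (X v)) inner_id inner_B_tilde -/n -/v.
  rewrite /cross_form innerDl innerBl.
  ring.
Qed.

(** The hypotheses on the cross form survive the change of sign: [- D] is no longer nonnegative, but
    only its symmetry, its square, its commutation and its range enter. *)
Lemma shorted_id_sub :
  shorted (bop_id (hsum H L) - BX) (suml_csubspace L N) =
  inl_op H L *o (incl_op N *o
    (Dn *o restr (shorted (bop_id (hsum N L) - X)
      (suml_csubspace L (full_csubspace N))) *o Dn) *o oproj N) *o fst_op H L.
Proof.
have A_sym : symmetric_op (- B_0 B).
  by move=> x y; rewrite !bopE innerNl innerNr B_0_sym.
have A_contr : contractive (- B_0 B).
  by move=> x; rewrite bopE normrN; exact: B_0_contr.
have E_sym : symmetric_op (- D).
  by move=> x y; rewrite !bopE innerNl innerNr D_sym.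
have E_comm : - D *o - B_0 B = - B_0 B *o - D.
  apply/bopP => x; rewrite -[LHS]/(- D (- B_0 B x)) -[RHS]/(- B_0 B (- D x)).
  by rewrite !bopN; exact: (congr1 (fun T : bop H0 H0 => - - T x) D_comm).
have E_sqr : - D *o - D = bop_id H0 - - B_0 B *o - B_0 B.
  apply/bopP => x; rewrite -[LHS]/(- D (- D x)).
  rewrite -[RHS]/(x - (- B_0 B (- B_0 B x))) !bopN !opprK.
  exact: (congr1 (fun T : bop H0 H0 => T x) D_sqr).
have C_closureN n : closure (range (- D)) (C n).
  have -> : range (- D) = range D.
    by apply/seteqP; split=> _ [x _ <-]; exists (- x) => //;
      rewrite ?bopE bopN ?opprK.
  exact: C_closure.
apply: (@shorted_factor _ _ _ _ _ _ _ C (cross_form (- B_0 B) (- D))).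
- exact: (nonneg_id_sub X_sym X_contr).
- exact: Dn_sym.
- move=> h n; apply: (cross_form_ge0 A_sym A_contr E_sym E_comm E_sqr).
  exact: C_closureN.
- move=> n e e0; apply: (cross_form_inf A_sym A_contr E_sym E_comm E_sqr) e0.
  exact: C_closureN.
- move=> u n v; rewrite (bop_subE _ BX) (bop_subE _ X) !bop_idE.
  rewrite (innerBl u (BX u)) (innerBl v (X v)) inner_id inner_B_tilde -/n -/v.
  rewrite /cross_form !bop_oppE innerBl opprK innerDl !innerNl.
  ring.
Qed.

End Extension.

(** * Passing from the shorted operators to the endpoints B_mu and B_M *)

Section Endpoints.
Context {R : realType} {H L : hilbertType R} {H0 : csubspace H}.
Let N := orthc H0.

Lemma block_sub_addr A11 A12 A21 (A22 A22' : bop N N) :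
  block_sub (H0 := H0) A11 A12 A21 (A22 + A22') =
  block_sub A11 A12 A21 A22 + incl_op N *o A22' *o oproj N.
Proof.
by apply/bopP => x; rewrite /block_sub !bop_addE !bop_compE bop_addE bopD addrA.
Qed.

Lemma restr_corner (A : bop H H) : restr (inl_op H L *o A *o fst_op H L) = A.
Proof. by apply/bopP => x. Qed.

Lemma restr_sub_id (T : bop (hsum H L) (hsum H L)) :
  restr (T - bop_id (hsum H L)) = restr T - bop_id H.
Proof. by apply/bopP => x. Qed.

Lemma restr_id_sub (T : bop (hsum H L) (hsum H L)) :
  restr (bop_id (hsum H L) - T) = bop_id H - restr T.
Proof. by apply/bopP => x. Qed.

Variables (B : bop H0 H) (K0 : bop (defect_space (B_0 B)) N).

(** With D = D_{K_0^*}, D (Y - I) D = D Y D - D^2, and -D^2 completes the corner entry of [B_mu]. *)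
Lemma B_hat_mu (Y : bop N N) : B_hat K0 (Y - bop_id N) =
  B_mu K0 + incl_op N *o (D_K0s K0 *o Y *o D_K0s K0) *o oproj N.
Proof.
rewrite -block_sub_addr; congr block_sub.
move: (KBK K0) (D_K0s K0) => S D; apply/bopP => n.
by rewrite !bopE bopB addrA addrAC.
Qed.

Lemma B_hat_M (Y : bop N N) : B_hat K0 (bop_id N - Y) =
  B_M K0 - incl_op N *o (D_K0s K0 *o Y *o D_K0s K0) *o oproj N.
Proof.
apply/eqP; rewrite eq_sym subr_eq; apply/eqP.
rewrite -block_sub_addr; congr block_sub.
move: (KBK K0) (D_K0s K0) => S D; apply/bopP => n.
by rewrite !bopE bopB addrA subrK.
Qed.

End Endpoints.

Unset Implicit Arguments.

Theorem theorem3p2 (R : realType)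
  (H : hilbertType R) (sepH : separable_space H)
  (H0 : csubspace H) (H0_proper : cs_set H0 <> setT)
  (B : bop H0 H) (B_contr : contractive B) (B_herm : hermitian_op B)
  (K0 : bop (defect_space (B_0 B)) (orthc H0)) (K0_contr : contractive K0)
  (K0E : forall f : H0, K0 (defect_cor (B_0 B) f) = oproj (orthc H0) (B f))
  (DK0s_full : cs_set (defect_space (adj K0)) = setT)
  (L : hilbertType R) (sepL : separable_space L)
  (X11 : bop (orthc H0) (orthc H0)) (X12 : bop L (orthc H0)) (X22 : bop L L)
  (X_selfadj :
     adj (block_sum X11 X12 (adj X12) X22) = block_sum X11 X12 (adj X12) X22)
  (X_contr : contractive (block_sum X11 X12 (adj X12) X22)) :
  let X := block_sum X11 X12 (adj X12) X22 in
  let BX := B_tilde K0 X11 X12 X22 in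
  let N := suml_csubspace L (orthc H0) in
  B_hat K0 (Z_hat0 X) =
    B_mu K0 + restr (shorted (bop_id (hsum H L) + BX) N) /\
  B_hat K0 (Z_hat1 X) =
    B_M K0 - restr (shorted (bop_id (hsum H L) - BX) N).
Proof.
move=> X BX N; split.
- rewrite (shorted_id_add B_contr B_herm K0_contr X_selfadj X_contr).
  by rewrite restr_corner /Z_hat0 restr_sub_id B_hat_mu.
- rewrite (shorted_id_sub B_contr B_herm K0_contr X_selfadj X_contr).
  by rewrite restr_corner /Z_hat1 restr_id_sub B_hat_M.
Qed.
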